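(* Let $p(\cdot):\mathbb{R}^n\to[1,\infty]$ be measurable with $p_+:=\operatorname{ess\,sup}_{x\in\mathbb{R}^n}p(x)<\infty$. Let $\rho=\{\rho_x\}_{x\in\mathbb{R}^n}$ be a family of norms on $\mathbb{C}^d$, and suppose that for every $x\in\mathbb{R}^n$ there is a positive-definite self-adjoint matrix $W_x$ with $$\rho_x(\mathbf{v})\le |W_x\mathbf{v}|\le d^{1/2}\rho_x(\mathbf{v})\quad\text{for all }\mathbf{v}\in\mathbb{C}^d,$$ where $x\mapsto W_x$ is an invertible matrix weight on $\mathbb{R}^n$ and $\|W_x\|_{op}^{p_+}\in L^1_{\rm loc}(\mathbb{R}^n)$. A subset $\mathcal{F}\subset L^{p(\cdot)}(\rho)$ is totally bounded in $L^{p(\cdot)}(\rho)$ if the following hold: (a) $\sup_{\mathbf{f}\in\mathcal{F}}\int_{\mathbb{R}^n}[\rho_x(\mathbf{f}(x))]^{p(x)}dx<\infty$; (b) $\lim_{R\to\infty}\sup_{\mathbf{f}\in\mathcal{F}}\int_{B^c(0,R)}[\rho_x(\mathbf{f}(x))]^{p(x)}dx=0$; (c) $\lim_{r\to0}\sup_{\mathbf{f}\in\mathcal{F}}\sup_{y\in B(0,r)}\int_{\mathbb{R}^n}[\rho_x(\tau_y\mathbf{f}(x)-\mathbf{f}(x))]^{p(x)}dx=0$, where $\tau_y\mathbf{f}(x):=\mathbf{f}(x-y)$.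
   Context: Lebesgue measure on $\mathbb{R}^n$ is used throughout; $B(0,R)$ is the Euclidean ball, $B^c$ its complement. It is assumed that $x\mapsto\rho_x(\mathbf{f}(x))$ is measurable for every measurable $\mathbf{f}:\mathbb{R}^n\to\mathbb{C}^d$. $L^{p(\cdot)}(\rho)$ is the set of measurable $\mathbf{f}:\mathbb{R}^n\to\mathbb{C}^d$ with $\int_{\mathbb{R}^n}[\rho_x(\mathbf{f}(x))]^{p(x)}dx<\infty$, normed by the Luxemburg norm $\|\mathbf{f}\|_{L^{p(\cdot)}(\rho)}:=\inf\{\lambda>0:\int_{\mathbb{R}^n}[\rho_x(\mathbf{f}(x))/\lambda]^{p(x)}dx\le1\}$. A matrix weight is a measurable map $W:\mathbb{R}^n\to\mathcal{S}_d$ (self-adjoint non-negative-definite complex $d\times d$ matrices) with $\|W\|_{op}\in L^1_{\rm loc}(\mathbb{R}^n)$; it is invertible if $\det W(x)\ne0$ a.e. $\|\cdot\|_{op}$ is the operator norm and $|\cdot|$ the Euclidean norm on $\mathbb{C}^d$. *)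

(* Defs.v *)
(* mathcomp-analysis (Lebesgue measure/integral on R) and
   real_closed complex numbers R[i]. *)
From HB Require Import structures.
From mathcomp Require Import all_boot all_order all_algebra.
From mathcomp Require Import all_classical all_reals all_analysis.
From mathcomp Require Import measurable_realfun.
From mathcomp Require Import complex.
Set Implicit Arguments.
Unset Strict Implicit.
Unset Printing Implicit Defensive.
Import Order.TTheory GRing.Theory Num.Theory.
Import numFieldNormedType.Exports.
Local Open Scope classical_set_scope.
Local Open Scope ring_scope.
Local Open Scope complex_scope.

(* ---------- Euclidean geometry of R^n and C^d ---------- *)
(* R^n is 'rV[R]_n, C^d is 'cV[R[i]]_d. *)

Definition eucl_rn (R : realType) (n : nat) (x : 'rV[R]_n) : R :=
  Num.sqrt (\sum_(i < n) (x 0 i) ^+ 2).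

(* Euclidean norm |v| on C^d *)
Definition eucl_cd (R : realType) (d : nat) (v : 'cV[R[i]]_d) : R :=
  Num.sqrt (\sum_(i < d) ((complex.Re (v i 0)) ^+ 2 + (complex.Im (v i 0)) ^+ 2)).

(* open Euclidean ball B(0,r) in R^n *)
Definition eball0 (R : realType) (n : nat) (r : R) : set 'rV[R]_n :=
  [set x | eucl_rn x < r].

(* operator norm of a d x d complex matrix w.r.t. the Euclidean norm *)
Definition opnorm (R : realType) (d : nat) (M : 'M[R[i]]_d) : R :=
  sup [set eucl_cd (M *m v) | v in [set v : 'cV[R[i]]_d | eucl_cd v = 1]].

(* conjugate transpose *)
Definition adjmx (R : realType) (m k : nat) (M : 'M[R[i]]_(m, k)) : 'M[R[i]]_(k, m) :=
  map_mx (fun z => z^*) (M^T).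

Definition self_adjoint (R : realType) (d : nat) (M : 'M[R[i]]_d) : Prop :=
  adjmx M = M.

Definition pos_definite (R : realType) (d : nat) (M : 'M[R[i]]_d) : Prop :=
  forall v : 'cV[R[i]]_d, v != 0 -> 0 < (adjmx v *m M *m v) 0 0.

(* a norm on C^d *)
Definition is_norm (R : realType) (d : nat) (N : 'cV[R[i]]_d -> R) : Prop :=
  [/\ forall v, 0 <= N v,
      forall v, N v = 0 -> v = 0,
      forall (c : R[i]) v, N (c *: v) = complex.Re `|c| * N v &
      forall v w, N (v + w) <= N v + N w].

(* ---------- Lebesgue measure / integral on R^n ---------- *)

(* Borel sets of R^n *)
Definition borel_rn (R : realType) (n : nat) (A : set 'rV[R]_n) : Prop :=
  <<s [set O : set 'rV[R]_n | open O] >> A.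

Definition borel_fun_rn (R : realType) (n : nat) (g : 'rV[R]_n -> \bar R) : Prop :=
  forall B : set (\bar R), measurable B -> borel_rn (g @^-1` B).

(* Iterated one-dimensional Lebesgue integrals; by Tonelli this is the
   n-dimensional Lebesgue integral of non-negative Borel functions. *)
Fixpoint intB (R : realType) (n : nat) : ('rV[R]_n -> \bar R) -> \bar R :=
  match n with
  | 0 => fun g => g 0
  | m.+1 => fun g =>
      (\int[lebesgue_measure]_t intB (fun v : 'rV[R]_m => g (row_mx (\row_(j < 1) t) v)))%E
  end.

(* Lebesgue-null sets of R^n *)
Definition null_rn (R : realType) (n : nat) (A : set 'rV[R]_n) : Prop :=
  exists Z, [/\ borel_rn Z, A `<=` Z & intB (fun x => (\1_Z x)%:E) = 0%E].

(* Lebesgue-measurable sets = completion of the Borel sets *)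
Definition lmeas (R : realType) (n : nat) (A : set 'rV[R]_n) : Prop :=
  exists B Z, [/\ borel_rn B, null_rn Z & A `&` ~` Z = B `&` ~` Z].

Definition lmeas_efun (R : realType) (n : nat) (g : 'rV[R]_n -> \bar R) : Prop :=
  forall B : set (\bar R), measurable B -> lmeas (g @^-1` B).

Definition lmeas_rfun (R : realType) (n : nat) (g : 'rV[R]_n -> R) : Prop :=
  forall B : set R, measurable B -> lmeas (g @^-1` B).

(* measurability of C^d-valued functions: real and imaginary parts of all
   coordinates are Lebesgue measurable *)
Definition lmeas_cfun (R : realType) (n d : nat) (f : 'rV[R]_n -> 'cV[R[i]]_d) : Prop :=
  forall i : 'I_d, lmeas_rfun (fun x => complex.Re (f x i 0)) /\ lmeas_rfun (fun x => complex.Im (f x i 0)).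

Definition lmeas_mfun (R : realType) (n d : nat) (W : 'rV[R]_n -> 'M[R[i]]_d) : Prop :=
  forall i j : 'I_d, lmeas_rfun (fun x => complex.Re (W x i j)) /\ lmeas_rfun (fun x => complex.Im (W x i j)).

(* Lebesgue integral over R^n of a non-negative function (outer integral:
   agrees with the Lebesgue integral on Lebesgue-measurable functions) *)
Definition lint (R : realType) (n : nat) (f : 'rV[R]_n -> \bar R) : \bar R :=
  ereal_inf [set intB g | g in [set g | borel_fun_rn g /\ (forall x, (f x <= g x)%E)]].

(* almost everywhere *)
Definition ae_rn (R : realType) (n : nat) (P : 'rV[R]_n -> Prop) : Prop :=
  null_rn [set x | ~ P x].

(* essential supremum *)
Definition ess_sup_rn (R : realType) (n : nat) (p : 'rV[R]_n -> \bar R) : \bar R :=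
  ereal_inf [set M : \bar R | ae_rn (fun x => (p x <= M)%E)].

(* locally integrable non-negative function *)
Definition L1loc (R : realType) (n : nat) (g : 'rV[R]_n -> R) : Prop :=
  lmeas_rfun g /\
  forall r : R, (lint (fun x => (\1_(eball0 r) x)%:E * (`|g x|)%:E) < +oo)%E.

(* invertible matrix weight *)
Definition inv_matrix_weight (R : realType) (n d : nat) (W : 'rV[R]_n -> 'M[R[i]]_d) : Prop :=
  [/\ lmeas_mfun W,
      (forall x, self_adjoint (W x) /\ forall v : 'cV[R[i]]_d, 0 <= (adjmx v *m W x *m v) 0 0),
      L1loc (fun x => opnorm (W x)) &
      ae_rn (fun x => \det (W x) != 0)].

(* ---------- variable exponent spaces ---------- *)

(* t^e for t >= 0 and e in [1, +oo]; for e = +oo we use the usual convention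
   t^oo = 0 if t <= 1 and +oo if t > 1 (only used on a null set here) *)
Definition epow (R : realType) (t : R) (e : \bar R) : \bar R :=
  match e with
  | EFin r => (t `^ r)%:E
  | EPInf => if t <= 1 then 0%E else +oo%E
  | ENInf => 0%E
  end.

(* the modular  int [rho_x(f(x))]^{p(x)} dx *)
Definition modular (R : realType) (n d : nat) (p : 'rV[R]_n -> \bar R)
    (rho : 'rV[R]_n -> 'cV[R[i]]_d -> R) (f : 'rV[R]_n -> 'cV[R[i]]_d) : \bar R :=
  lint (fun x => epow (rho x (f x)) (p x)).

(* membership in L^{p(.)}(rho) *)
Definition in_Lp (R : realType) (n d : nat) (p : 'rV[R]_n -> \bar R)
    (rho : 'rV[R]_n -> 'cV[R[i]]_d -> R) (f : 'rV[R]_n -> 'cV[R[i]]_d) : Prop :=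
  lmeas_cfun f /\ (modular p rho f < +oo)%E.

(* Luxemburg norm *)
Definition lux (R : realType) (n d : nat) (p : 'rV[R]_n -> \bar R)
    (rho : 'rV[R]_n -> 'cV[R[i]]_d -> R) (f : 'rV[R]_n -> 'cV[R[i]]_d) : \bar R :=
  ereal_inf [set (lam%:E) | lam in
    [set lam : R | 0 < lam /\ (modular p rho (fun x => (lam^-1)%:C *: f x) <= 1)%E]].

(* total boundedness in L^{p(.)}(rho) (finite eps-nets in the space) *)
Definition totally_bounded_Lp (R : realType) (n d : nat) (p : 'rV[R]_n -> \bar R)
    (rho : 'rV[R]_n -> 'cV[R[i]]_d -> R) (F : set ('rV[R]_n -> 'cV[R[i]]_d)) : Prop :=
  forall eps : R, 0 < eps ->
    exists (k : nat) (g : 'I_k -> 'rV[R]_n -> 'cV[R[i]]_d),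
      (forall j, in_Lp p rho (g j)) /\
      forall f, F f -> exists j : 'I_k, (lux p rho (fun x => (f x - g j x)%R) < eps%:E)%E.

(* Main.v *)
(** Rather than averaging [f] over cubes, which would require its local
    integrability, we sample it: if [q x] is the corner of the cube of side
    [l] containing [x], then Tonelli and translation invariance show that the
    mean over [s] in [0, l)^n of int rho_x (f (q x + s) - f x)^p(x) dx is at
    most [2^n] times the supremum in (c) over |y_i| <= l, so some offset [s]
    makes the piecewise constant function [x |-> f (q x + s)] close to [f].
    On a ball this function has finitely many values, and they are bounded
    uniformly in [f]: on every cube Q the modular of a constant vector [v]
    grows with |v|, since W_x is invertible for almost every x.  Rounding these
    values gives a code in a finite set, and two functions with the same code
    are close, because ||W_x||^p+ is locally integrable.  The net consists of
    one member of [F] for each code that occurs. *)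
Require Import Defs.
From HB Require Import structures.
From mathcomp Require Import all_boot all_order all_algebra.
From mathcomp Require Import all_classical all_reals all_analysis.
From mathcomp Require Import measurable_realfun.
From mathcomp Require Import complex.
From mathcomp Require Import ring lra zify.
Import Order.TTheory GRing.Theory Num.Theory.
Import numFieldNormedType.Exports.
Local Open Scope classical_set_scope.
Local Open Scope ring_scope.
Local Open Scope complex_scope.
Set Implicit Arguments.
Unset Strict Implicit.
Unset Printing Implicit Defensive.

(** * Borel sets of R^n and the iterated integral *)

(** The statement uses iterated integrals and an outer integral, so no measure is given beforehand.
    A sigma-finite [mu] representing [intB] is built once; Tonelli, translation invariance and
    almost everywhere arguments then apply. The data p, W and each f are replaced by Borel versions,
    and the outer integral reappears only at the end.

    Tonelli is applied to functions of (x, s), which calls for an integrand jointly measurable in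
    the point and the vector. Hence rho_x(v)^p(x) is replaced by [Phi], a power of an l1 norm of W_x
    v, comparable to it with constants depending only on d and P. Because 1 <= p <= P, these powers
    obey a triangle inequality with constant 3^P, are at most linear near 0 and at least linear near
    infinity; the last two facts drive the rounding and the boundedness of the samples.

    Having a code is a relation, since a good offset is not unique. Functions sharing a code may use
    different offsets: only their sampled values are compared. *)

Notation borel_space R n := (g_sigma_algebraType [set O : set 'rV[R]_n | open O]).

Lemma borel_fun_rnE (R : realType) (n : nat) (g : 'rV[R]_n -> \bar R) :
  borel_fun_rn g <-> measurable_fun [set: borel_space R n] g.
Proof.
split=> [mg _ B mB|mg B mB]; first by rewrite setTI; exact: mg.
by have := mg measurableT B mB; rewrite setTI.
Qed.

(** An open set is the countable union of the boxes with rational centre and radius 1/(k+1) that it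
    contains, and the preimage of a box is a finite intersection of conditions on single
    coordinates. *)
Lemma measurable_row (R : realType) (n : nat) d (T : measurableType d)
    (h : T -> 'rV[R]_n) :
  (forall i, measurable_fun [set: T] (fun t => h t 0 i)) ->
  measurable_fun [set: T] (h : T -> borel_space R n).
Proof.
move=> mh mT B mB; rewrite setTI.
have -> : h @^-1` B = [set: T] `&` h @^-1` B by rewrite setTI.
apply: (@measurability _ _ _ (borel_space R n) [set: T] h
  [set O : set 'rV[R]_n | open O] erefl) => //.
move=> _ [U oU <-].
rewrite setTI.
pose box (c : 'rV[rat]_n) (k : nat) : set 'rV[R]_n :=
  [set x | forall i, `|ratr (c 0 i) - x 0 i| < k.+1%:R^-1].
pose I := [set ck : 'rV[rat]_n * nat | box ck.1 ck.2 `<=` U].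
have -> : U = \bigcup_(ck in I) box ck.1 ck.2.
  apply/seteqP; split=> [x Ux|x [ck Ick]]; last exact: Ick.
  have /nbhs_ballP[e e0 eU] : nbhs x U by apply: open_nbhs_nbhs.
  rewrite /= in e0.
  have [k ke] : exists k : nat, k.+1%:R^-1 < e / 2 :> R.
    have [k _ hk] := near_infty_natSinv_lt (PosNum (divr_gt0 e0 (ltr0Sn R 1))).
    by exists k; apply: (hk k) => /=.
  have q_ i : exists q : rat, `|ratr q - x 0 i| < k.+1%:R^-1.
    have xk : x 0 i < x 0 i + k.+1%:R^-1 by rewrite ltrDl invr_gt0 ltr0n.
    have [q] := rat_in_itvoo xk; rewrite in_itv/= => /andP[q1 q2].
    by exists q; rewrite gtr0_norm ?subr_gt0// ltrBlDl.
  have [q hq] := choice q_.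
  exists (\row_i q i, k) => [/= y hy|/=]; last first.
    by move=> i; rewrite mxE; exact: hq.
  apply: eU; split=> // i j; rewrite ord1 /ball/=.
  have := hy j; have := hq j; rewrite mxE /= => h1 h2.
  rewrite -(subrKA (ratr (q j))) (le_lt_trans (ler_normD _ _))//.
  by rewrite distrC [e]splitr ltrD// (lt_trans _ ke).
rewrite preimage_bigcup bigcup_mkcond; apply: countable_bigcupT_measurable => //.
move=> [c k]/=; case: ifPn => // _.
rewrite (_ : _ @^-1` _ = \bigcap_(i in [set: 'I_n])
    (h @^-1` [set x | `|ratr (c 0 i) - x 0 i| < k.+1%:R^-1])); last first.
  by apply/seteqP; split=> [t ht i _|t ht i]; apply: ht.
apply: fin_bigcap_measurable => // i _.
rewrite -[X in measurable X]setTI.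
have mt : measurable [set true] by [].
have /(_ measurableT [set true] mt) := measurable_fun_ltr
  (measurableT_comp (@normr_measurable R setT)
     (measurable_funB (measurable_cst (ratr (c 0 i) : R)) (mh i)))
  (measurable_cst (k.+1%:R^-1 : R)).
by congr measurable; apply/seteqP; split => t /=; rewrite ?inE.
Qed.

Lemma measurable_coord (R : realType) (n : nat) (i : 'I_n) :
  measurable_fun [set: borel_space R n] (fun x : 'rV[R]_n => x 0 i).
Proof.
move=> _ B mB; rewrite setTI.
rewrite -[X in measurable X]setTI.
apply: (@measurability _ _ (borel_space R n) (measurableTypeR R) setT _ _
  (RGenOpens.measurableE R)) mB => //.
move=> _ [U [a [b ->]] <-]; rewrite setTI; apply: sub_sigma_algebra => /=.
apply: open_comp; last exact: interval_open.
by move=> x _; exact: coord_continuous.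
Qed.

Lemma measurable_rowP (R : realType) (n : nat) d (T : measurableType d)
    (h : T -> 'rV[R]_n) :
  measurable_fun [set: T] (h : T -> borel_space R n) <->
  forall i, measurable_fun [set: T] (fun t => h t 0 i).
Proof.
split=> [mh i|]; last exact: measurable_row.
exact: (measurableT_comp (@measurable_coord R n i) mh).
Qed.

(** * The iterated integral as an integral against a measure *)

Section intB_pure.
Variable R : realType.
Local Open Scope ereal_scope.

Definition hcons n (t : R) (v : 'rV[R]_n) : 'rV[R]_n.+1 :=
  row_mx (\row_(j < 1) t) v.

Lemma hcons0 n t (v : 'rV[R]_n) : hcons t v 0%R ord0 = t.
Proof.
transitivity (row_mx (\row_(j < 1) t) v 0%R (lshift n ord0)).
  by congr (row_mx _ _ _ _); apply: ord_inj.
by rewrite row_mxEl mxE.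
Qed.

Lemma hconsS n t (v : 'rV[R]_n) i : hcons t v 0%R (lift ord0 i) = v 0%R i.
Proof.
rewrite -(row_mxEr (\row_(j < 1) t) v 0%R i).
by congr (row_mx _ _ _ _); apply: ord_inj.
Qed.

(** Half-open, so that the translates of [cube 0 l] by the lattice of step [l] partition R^n. *)
Definition cube n (a b : R) : set 'rV[R]_n :=
  [set x | forall i, (a <= x 0 i < b)%R].

Lemma cube_hcons n (a b t : R) (v : 'rV[R]_n) :
  cube a b (hcons t v) <-> (a <= t < b)%R /\ cube a b v.
Proof.
split=> [h|[ht hv] i].
  split; first by have := h ord0; rewrite hcons0.
  by move=> i; have := h (lift ord0 i); rewrite hconsS.
by case: (unliftP ord0 i) => [j|] ->; rewrite ?hconsS ?hcons0.
Qed.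

Lemma indic_cube_hcons n (a b t : R) (v : 'rV[R]_n) :
  (\1_(cube a b) (hcons t v) = \1_(`[a, b[%classic) t * \1_(cube a b) v :> R)%R.
Proof.
rewrite !indicE -natrM mulnb; congr (nat_of_bool _)%:R.
apply/idP/andP => [/set_mem/cube_hcons[h1 h2]|[/set_mem h1 /set_mem h2]].
  by split; apply/mem_set => //=; rewrite in_itv.
by apply/mem_set/cube_hcons; split=> //; rewrite /= in_itv in h1.
Qed.

Lemma intB0 n : intB (fun _ : 'rV[R]_n => 0) = 0.
Proof. by elim: n => //= n IH; apply: integral0_eq => t _; exact: IH. Qed.

Lemma intB_cube n (a b : R) : (a <= b)%R ->
  intB (fun x : 'rV[R]_n => (\1_(cube a b) x)%:E) = ((b - a) ^+ n)%:E.
Proof.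
move=> ab; elim: n => [|n IH] /=.
  by rewrite indicE mem_set// => -[].
transitivity (\int[@lebesgue_measure R]_t
    (((b - a) ^+ n)%:E * (\1_(`[a, b[%classic) t)%:E)); last first.
  rewrite ge0_integralZl_EFin//.
  - rewrite integral_indic//= setIT lebesgue_measure_itv/= lte_fin.
    case: ltgtP ab => // [ab _|-> _]; rewrite -?EFinD -?EFinM ?exprSr//.
    by rewrite subrr !mulr0.
  - exact/measurable_EFinP.
  - by rewrite exprn_ge0// subr_ge0.
apply: eq_integral => t _; rewrite -IH.
rewrite indicE; case: (boolP (t \in _)) => tab.
  rewrite mule1; congr intB; apply/funext => v.
  by rewrite -/(hcons t v) indic_cube_hcons indicE tab mul1r.
rewrite mule0 -(intB0 n); congr intB; apply/funext => v.
by rewrite -/(hcons t v) indic_cube_hcons indicE (negbTE tab) mul0r.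
Qed.

End intB_pure.

Lemma measurable_hcons (R : realType) n :
  measurable_fun [set: measurableTypeR R * borel_space R n]
    ((fun tv => hcons tv.1 tv.2) : _ -> borel_space R n.+1).
Proof.
apply: measurable_row => i; case: (unliftP ord0 i) => [j|] ->.
  apply: (@eq_measurable_fun _ _ _ _ _
    (fun t : measurableTypeR R * borel_space R n => (t.2 : 'rV[R]_n) 0 j)).
    by move=> t _ /=; rewrite hconsS.
  exact: measurableT_comp (@measurable_coord R n j) measurable_snd.
apply: (@eq_measurable_fun _ _ _ _ _ fst).
  by move=> t _ /=; rewrite hcons0.
exact: measurable_fst.
Qed.

Lemma measurable_cube (R : realType) n (a b : R) :
  measurable (cube a b : set (borel_space R n)).
Proof.
rewrite (_ : cube a b = \bigcap_(i in [set: 'I_n])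
   ((fun x : 'rV[R]_n => x 0 i) @^-1` `[a, b[%classic)).
  apply: fin_bigcap_measurable => // i _.
  by rewrite -[X in measurable X]setTI; apply: measurable_coord.
by apply/seteqP; split=> [t ht i _|t ht i]; have := ht i; rewrite /= in_itv//=; apply.
Qed.

Lemma measurable_EFin_indic d (T : measurableType d) (R : realType) (A : set T) :
  measurable A -> measurable_fun [set: T] (fun x => (\1_A x)%:E : \bar R).
Proof. by move=> mA; exact/measurable_EFinP/measurable_indic. Qed.

(** Tonelli's theorem is stated for the bundled structure; the property is packed into it without
    changing the set function. *)
Lemma sigma_finite_measureP d (T : measurableType d) (R : realType)
    (m : {measure set T -> \bar R}) :
  sigma_finite setT m ->
  exists m' : {sigma_finite_measure set T -> \bar R}, m' = m :> (set T -> \bar R).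
Proof.
move=> m_sf.
pose H1 := isSFinite.Build _ _ _ _ (sfinite_measure_sigma_finite m_sf).
pose H2 := isSigmaFinite.Build _ _ _ _ m_sf.
pose m' := HB.pack_for (SigmaFiniteMeasure.type T R) (Measure.sort m) H1 H2.
by exists m'.
Qed.

Lemma bigcup_cube (R : realType) n :
  \bigcup_k cube (- k%:R) k%:R = [set: 'rV[R]_n].
Proof.
apply/seteqP; split=> // x _.
have [k hk] : exists k : nat, forall i, `|x 0 i| < k%:R.
  exists (\max_i (Num.trunc `|x 0%R i|).+1)%N => i.
  rewrite (lt_le_trans (truncnS_gt _))// ler_nat.
  exact: (leq_bigmax (F := fun i => (Num.trunc `|x 0%R i|).+1)).
exists k => // i; have := hk i; rewrite ltr_norml => /andP[h1 h2].
by rewrite h2 ltW.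
Qed.

(** By induction: the measure in dimension n+1 is the image under [hcons] of the product of
    one-dimensional Lebesgue measure with the measure in dimension n, and Tonelli turns its integral
    into the iterated one. In dimension 0 it is the Dirac mass. *)
Lemma intB_measure (R : realType) n :
  exists mu : {sigma_finite_measure set (borel_space R n) -> \bar R},
    forall g : 'rV[R]_n -> \bar R,
      measurable_fun [set: borel_space R n] g -> (forall x, 0 <= g x)%E ->
      intB g = (\int[mu]_x g x)%E.
Proof.
elim: n => [|n [mu IH]].
  exists (@dirac _ (borel_space R 0) 0 R) => g mg g0 /=.
  by rewrite integral_dirac ?diracT ?mul1e.
pose phi := (fun tv => hcons tv.1 tv.2) : measurableTypeR R * borel_space R n -> borel_space R n.+1.
have mphi : measurable_fun setT phi by exact: measurable_hcons.
have @nu : {measure set (borel_space R n.+1) -> \bar R}.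
  refine (pushforward (@lebesgue_measure R \x mu)%E phi : {measure set _ -> \bar R}).
  exact: mphi.
have nuE (g : 'rV[R]_n.+1 -> \bar R) :
    measurable_fun [set: borel_space R n.+1] g -> (forall x, 0 <= g x)%E ->
    intB g = (\int[nu]_x g x)%E.
  move=> mg g0.
  rewrite [RHS](@ge0_integral_pushforward _ _ _ _ _ phi)//=.
  rewrite preimage_setT fubini_tonelli1//; last exact: measurableT_comp.
  apply: eq_integral => t _; rewrite /fubini_F IH//.
  exact: measurableT_comp mg (measurableT_comp mphi (pair1_measurable t)).
(* The cubes [-k, k)^(n+1) exhaust the space, and their measure is finite by the explicit value of
   [intB] on cubes. *)
have nu_sf : sigma_finite setT nu.
  exists (fun k => cube (- k%:R) k%:R) => [|k].
    by rewrite bigcup_cube.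
  split; first exact: measurable_cube.
  rewrite -[X in nu X]setIT -integral_indic//; last exact: measurable_cube.
  rewrite -nuE; last 2 first.
  - exact: (measurable_EFin_indic (measurable_cube _ _)).
  - by move=> x; rewrite lee_fin.
  by rewrite intB_cube ?ltry// (@le_trans _ _ 0)// oppr_le0.
have [nu' nu'E] := sigma_finite_measureP nu_sf.
by exists nu' => g mg g0; rewrite nuE// nu'E.
Qed.

(** * Translation invariance, null sets and the outer integral *)

(** The image of Lebesgue measure under translation gives every interval its length, hence equals
    Lebesgue measure by uniqueness. *)
Lemma lebesgue_integral_translation (R : realType) (c : R) (h : R -> \bar R) :
  measurable_fun [set: measurableTypeR R] h -> (forall t, 0 <= h t)%E ->
  (\int[@lebesgue_measure R]_t h (t + c)%R = \int[@lebesgue_measure R]_t h t)%E.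
Proof.
move=> mh h0.
pose phi := (fun t => t + c) : measurableTypeR R -> measurableTypeR R.
have mphi : measurable_fun setT phi.
  by apply: measurable_funD; [exact: measurable_id|exact: measurable_cst].
have @nu : {measure set (measurableTypeR R) -> \bar R}.
  refine (pushforward (@lebesgue_measure R) phi : {measure set _ -> \bar R}).
  exact: mphi.
have nuE : forall A, measurable A -> lebesgue_measure A = nu A.
  apply: lebesgue_measure_unique => _ [[a b] _ <-].
  rewrite /nu /= /pushforward.
  rewrite (_ : phi @^-1` _ = `]a - c, b - c]%classic); last first.
    by apply/seteqP; split => t /=; rewrite !in_itv/= ltrBlDr lerBrDr.
  rewrite /= !lebesgue_measure_itv/= !lte_fin ltrD2r.
  by case: ifPn => // _; rewrite -!EFinD; congr EFin; lra.
rewrite [RHS](eq_measure_integral nu); last by move=> A mA _; exact: nuE.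
by rewrite [RHS](@ge0_integral_pushforward _ _ _ _ _ phi)//= preimage_setT.
Qed.

(** The property supplied by [intB_measure], carried as a hypothesis so that later arguments do not
    depend on how the measure was built. *)
Definition represents_intB (R : realType) n
    (mu : {sigma_finite_measure set (borel_space R n) -> \bar R}) :=
  forall g : 'rV[R]_n -> \bar R,
    measurable_fun [set: borel_space R n] g -> (forall x, 0 <= g x)%E ->
    intB g = (\int[mu]_x g x)%E.

Lemma measurable_addrow (R : realType) n d (T : measurableType d)
    (f g : T -> 'rV[R]_n) :
  measurable_fun [set: T] (f : T -> borel_space R n) ->
  measurable_fun [set: T] (g : T -> borel_space R n) ->
  measurable_fun [set: T] ((fun t => f t + g t) : T -> borel_space R n).
Proof.
move=> /measurable_rowP mf /measurable_rowP mg; apply/measurable_rowP => i.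
apply: (@eq_measurable_fun _ _ _ _ _ ((fun t => f t 0 i) \+ (fun t => g t 0 i))).
  by move=> t _ /=; rewrite mxE.
exact: measurable_funD.
Qed.

Lemma hconsD (R : realType) n (t : R) (v : 'rV[R]_n) (c : 'rV[R]_n.+1) :
  hcons t v + c = hcons (t + c 0 ord0) (v + \row_i c 0 (lift ord0 i)).
Proof.
apply/rowP => i; rewrite mxE; case: (unliftP ord0 i) => [j|] ->.
  by rewrite !hconsS !mxE.
by rewrite !hcons0.
Qed.

(** Induction on the dimension: the hypothesis absorbs the shift of the tail, the one-dimensional
    case that of the head. The representing measure serves to show that the inner integral is
    measurable. *)
Lemma intB_translation (R : realType) n (c : 'rV[R]_n) (g : 'rV[R]_n -> \bar R) :
  measurable_fun [set: borel_space R n] g -> (forall x, 0 <= g x)%E ->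
  intB (fun x => g (x + c)) = intB g.
Proof.
elim: n c g => [|n IH] c g mg g0 /=.
  by congr g; apply/rowP => -[].
have mgt t : measurable_fun [set: borel_space R n] (fun v => g (hcons t v)).
  exact: measurableT_comp mg (measurableT_comp (@measurable_hcons R n) (pair1_measurable t)).
pose k t := intB (fun v : 'rV[R]_n => g (hcons t v)).
transitivity (\int[@lebesgue_measure R]_t k (t + c 0 ord0)%R)%E.
  apply: eq_integral => t _; rewrite /k.
  rewrite -(IH (\row_i c 0 (lift ord0 i)) _ (mgt _))//.
  by congr intB; apply/funext => v; rewrite -hconsD.
have [mu muE] := intB_measure R n.
apply: lebesgue_integral_translation; last first.
  by move=> t; rewrite /k muE//; exact: integral_ge0.
rewrite (_ : k = fubini_F mu (fun tv => g (hcons tv.1 tv.2))).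
  apply: measurable_fun_fubini_tonelli_F => //.
  exact: measurableT_comp mg (@measurable_hcons R n).
by apply/funext => t; rewrite /k muE.
Qed.

Section representing_measure.
Variables (R : realType) (n : nat).
Variable mu : {sigma_finite_measure set (borel_space R n) -> \bar R}.
Hypothesis muE : represents_intB mu.

Lemma ge0_integral_translation (c : 'rV[R]_n) (g : 'rV[R]_n -> \bar R) :
  measurable_fun [set: borel_space R n] g -> (forall x, 0 <= g x)%E ->
  (\int[mu]_x g (x + c)%R = \int[mu]_x g x)%E.
Proof.
move=> mg g0; rewrite -!muE//; first exact: intB_translation.
apply: (measurableT_comp mg); apply: (@measurable_addrow R n _ (borel_space R n)).
  exact: measurable_id.
exact: (@measurable_cst _ _ _ (borel_space R n)).
Qed.

Lemma intB_indic (A : set 'rV[R]_n) : borel_rn A ->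
  intB (fun x => (\1_A x)%:E) = mu A.
Proof.
move=> mA; rewrite muE; last 2 first.
- exact: (@measurable_EFin_indic _ (borel_space R n)).
- by move=> x; rewrite lee_fin.
by rewrite integral_indic// setIT.
Qed.

Lemma measure_cube (a b : R) : a <= b ->
  mu (cube a b : set 'rV[R]_n) = ((b - a) ^+ n)%:E.
Proof.
by move=> ab; rewrite -intB_indic ?intB_cube//; exact: measurable_cube.
Qed.

Lemma null_rnP (A : set 'rV[R]_n) : null_rn A <-> mu.-negligible A.
Proof.
split=> [[Z [mZ AZ Z0]]|[Z [mZ Z0 AZ]]]; exists Z; split => //.
  by rewrite -intB_indic.
by rewrite intB_indic.
Qed.

Lemma ae_rnP (P : 'rV[R]_n -> Prop) : ae_rn P <-> {ae mu, forall x, P x}.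
Proof. exact: null_rnP. Qed.

(** The infimum in [lint] runs over majorants valid everywhere; raising [g] to +oo on the
    exceptional null set produces one with the same integral. *)
Lemma lint_le_integral (f g : 'rV[R]_n -> \bar R) :
  measurable_fun [set: borel_space R n] g -> (forall x, 0 <= g x)%E ->
  {ae mu, forall x, (f x <= g x)%E} -> (lint f <= \int[mu]_x g x)%E.
Proof.
move=> mg g0 [Z [mZ Z0 fgZ]].
pose h := (fun x => if x \in Z then +oo else g x)%E.
have mh : measurable_fun [set: borel_space R n] h.
  apply: measurable_fun_ifT => //.
  apply: (@measurable_fun_bool _ _ _ _ true).
  by rewrite setTI (_ : _ @^-1` _ = Z)//; apply/seteqP; split => x; [exact: set_mem|exact: mem_set].
have h0 x : (0 <= h x)%E by rewrite /h; case: ifP.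
apply: (@le_trans _ _ (intB h)).
  apply: ereal_inf_lbound; exists h => //; split; first exact/borel_fun_rnE.
  move=> x; rewrite /h; case: ifPn => [_|/negP xZ]; first exact: leey.
  by apply: contrapT => fg; apply: xZ; rewrite inE; exact: fgZ.
rewrite muE// (@ge0_ae_eq_integral _ _ _ mu _ h g)//.
exists Z; split => // x /= hx; apply: contrapT => xZ; apply: hx => _.
by rewrite /h ifN//; apply/negP; rewrite inE.
Qed.

(** Every Borel majorant of [f] bounds [g] almost everywhere, so its integral bounds that of [g];
    the infimum then does too. *)
Lemma integral_le_lint (f g : 'rV[R]_n -> \bar R) :
  (forall x, 0 <= f x)%E ->
  measurable_fun [set: borel_space R n] g -> (forall x, 0 <= g x)%E ->
  {ae mu, forall x, (g x <= f x)%E} -> (\int[mu]_x g x <= lint f)%E.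
Proof.
move=> f0 mg g0 gf; apply: le_ereal_inf_tmp => _ [h [/borel_fun_rnE mh fh] <-].
have h0 x : (0 <= h x)%E by exact: le_trans (fh x).
rewrite muE//; apply: ae_ge0_le_integral => //.
move: gf => [Z [mZ Z0 ZP]]; exists Z; split => // x hx; apply: ZP => gfx.
by apply: hx => _; exact: le_trans (fh x).
Qed.

(** Each superlevel set at a rational level is Borel off a null set. Off the union of these
    countably many null sets, {g > a} is the union of the Borel sets at the rational levels above
    a. *)
Lemma lmeas_rfun_measurable (g : 'rV[R]_n -> R) : lmeas_rfun g ->
  exists Z : set (borel_space R n), [/\ measurable Z, mu Z = 0%E &
    measurable_fun (~` Z : set (borel_space R n)) g].
Proof.
move=> mg.
pose q_ (k : nat) : R := ratr (odflt 0 (unpickle k : option rat)).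
have BZ_ k : exists BZ : set (borel_space R n) * set (borel_space R n),
    [/\ measurable BZ.1, measurable BZ.2, mu BZ.2 = 0%E &
    forall x, ~ BZ.2 x -> BZ.1 x <-> q_ k < g x].
  have [B [Z0 [mB /null_rnP[Z [mZ Z00 Z0Z]] gB]]] :
    lmeas (g @^-1` `]q_ k, +oo[%classic) by apply: mg.
  exists (B, Z); split => //= x Zx.
  have Z0x : ~ Z0 x by move=> /Z0Z.
  split=> [Bx|gx].
    have : (B `&` ~` Z0) x by [].
    by rewrite -gB => -[]/=; rewrite in_itv/= andbT.
  suff : (B `&` ~` Z0) x by case.
  by rewrite -gB; split => //=; rewrite in_itv/= andbT.
have [BZ hBZ] := choice BZ_.
exists (\bigcup_k (BZ k).2); split.
- by apply: bigcupT_measurable => k; case: (hBZ k).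
- apply/negligibleP; first by apply: bigcupT_measurable => k; case: (hBZ k).
  apply: negligible_bigcup => k; apply/negligibleP; by case: (hBZ k).
move=> mD.
apply: (@measurability _ _ (borel_space R n) (measurableTypeR R) _ _ _
  (RGenOInfty.measurableE R)) => // _ [_ [a ->] <-].
rewrite (_ : _ `&` _ = ~` (\bigcup_k (BZ k).2) `&`
    \bigcup_(k in [set k | a < q_ k]) (BZ k).1).
  apply: measurableI => //; rewrite bigcup_mkcond.
  by apply: bigcupT_measurable => k; case: ifPn => // _; case: (hBZ k).
apply/seteqP; split=> x [Zx]/=; rewrite in_itv/= ?andbT => h; split=> //.
  have [q] := rat_in_itvoo h; rewrite in_itv/= => /andP[aq qg].
  exists (pickle q); first by rewrite /= /q_ pickleK.
  have [_ _ _ hx] := hBZ (pickle q).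
  by apply/hx; [move=> Zqx; apply: Zx; exists (pickle q)|rewrite /q_ pickleK].
move: h => [k /= ak Bx]; have [_ _ _ hx] := hBZ k.
rewrite (lt_trans ak)//; apply/hx => // Zkx; apply: Zx; by exists k.
Qed.

End representing_measure.

(** * An l1 norm on C^d and elementary inequalities *)

Section complex_l1.
Variable R : realType.
Implicit Types (z w : R[i]).

Definition cabs1 z : R := `|complex.Re z| + `|complex.Im z|.
Definition cnormsq z : R := complex.Re z ^+ 2 + complex.Im z ^+ 2.
(** Preferred to [eucl_cd], to which it is equivalent: the triangle inequality and measurability are
    read off coordinate by coordinate. *)
Definition N1 d (v : 'cV[R[i]]_d) : R := \sum_i cabs1 (v i 0).

Lemma cabs1_ge0 z : 0 <= cabs1 z. Proof. by rewrite addr_ge0. Qed.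

Lemma cnormsq_ge0 z : 0 <= cnormsq z. Proof. by rewrite addr_ge0 ?sqr_ge0. Qed.

Lemma cnormsq_eq0 z : cnormsq z = 0 -> z = 0.
Proof.
case: z => a b /eqP; rewrite paddr_eq0 ?sqr_ge0// !sqrf_eq0 /= => /andP[].
by move=> /eqP-> /eqP->.
Qed.

Lemma cabs1D z w : cabs1 (z + w) <= cabs1 z + cabs1 w.
Proof.
case: z w => [a b] [c e]; rewrite /cabs1 /=.
by rewrite addrACA lerD ?ler_normD.
Qed.

Lemma cabs10 : cabs1 0 = 0. Proof. by rewrite /cabs1 /= normr0 addr0. Qed.

Lemma cabs1N z : cabs1 (- z) = cabs1 z.
Proof. by case: z => a b; rewrite /cabs1 /= !normrN. Qed.

Lemma cabs1M z w : cabs1 (z * w) <= cabs1 z * cabs1 w.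
Proof.
case: z w => [a b] [c e]; rewrite /cabs1 /=.
have h1 := ler_normB (a * c) (b * e).
have h2 := ler_normD (a * e) (b * c).
rewrite !normrM in h1 h2.
by rewrite (le_trans (lerD h1 h2))// mulrDl !mulrDr; lra.
Qed.

(** A substitute for multiplicativity, which the l1 norm on C lacks: multiply z w by the conjugate
    of z and use submultiplicativity. *)
Lemma cabs1_lower z w : cnormsq z * cabs1 w <= cabs1 z * cabs1 (z * w).
Proof.
have -> : cnormsq z * cabs1 w = cabs1 (z^* * (z * w)).
  case: z w => [a b] [c e]; rewrite /cabs1 /cnormsq /=.
  rewrite mulrDr -[a ^+ 2 + b ^+ 2]ger0_norm ?addr_ge0 ?sqr_ge0// -!normrM.
  have -> : (a ^+ 2 + b ^+ 2) * c = a * (a * c - b * e) - - b * (a * e + b * c) by ring.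
  by have -> : (a ^+ 2 + b ^+ 2) * e = a * (a * e + b * c) + - b * (a * c - b * e) by ring.
apply: (le_trans (cabs1M _ _)); rewrite ler_wpM2r ?cabs1_ge0//.
by case: z => a b; rewrite /cabs1 /= normrN.
Qed.

Lemma cabs1_real (r : R) z : cabs1 (r%:C * z) = `|r| * cabs1 z.
Proof.
case: z => a b; rewrite /cabs1 /= !mul0r subr0 addr0 !normrM mulrDr.
by congr (_ + _).
Qed.

Lemma cabs1_sum I (s : seq I) (P : pred I) (F : I -> R[i]) :
  cabs1 (\sum_(i <- s | P i) F i) <= \sum_(i <- s | P i) cabs1 (F i).
Proof.
elim/big_rec2: _ => [|i y x _ h]; first by rewrite cabs10.
by rewrite (le_trans (cabs1D _ _))// lerD2l.
Qed.

Section vectors.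
Variable d : nat.
Implicit Types (u v : 'cV[R[i]]_d) (M : 'M[R[i]]_d).

Lemma N1_ge0 v : 0 <= N1 v.
Proof. by apply: sumr_ge0 => i _; exact: cabs1_ge0. Qed.

Lemma N1D u v : N1 (u + v) <= N1 u + N1 v.
Proof. by rewrite -big_split ler_sum// => i _; rewrite mxE cabs1D. Qed.

Lemma N1N v : N1 (- v) = N1 v.
Proof. by apply: eq_bigr => i _; rewrite mxE cabs1N. Qed.

Lemma N1_real (r : R) v : N1 (r%:C *: v) = `|r| * N1 v.
Proof. by rewrite /N1 mulr_sumr; apply: eq_bigr => i _; rewrite mxE cabs1_real. Qed.

Lemma N1_mulmx M v : N1 (M *m v) <= (\sum_i \sum_j cabs1 (M i j)) * N1 v.
Proof.
rewrite /N1 mulr_suml; apply: ler_sum => i _.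
rewrite mxE (le_trans (cabs1_sum _ _ _))// mulr_suml ler_sum// => j _.
rewrite (le_trans (cabs1M _ _))// ler_wpM2l ?cabs1_ge0//.
by rewrite (bigD1 j)//= lerDl sumr_ge0// => k _; exact: cabs1_ge0.
Qed.

(** The bound |v| <= |M^-1| |M v| with denominators cleared, obtained from adj(M) M = det(M). Its
    coefficients depend measurably on M. *)
Lemma N1_det_lower M v :
  cnormsq (\det M) * N1 v <=
  cabs1 (\det M) * (\sum_i \sum_j cabs1 ((\adj M) i j)) * N1 (M *m v).
Proof.
apply: (@le_trans _ _ (cabs1 (\det M) * N1 (\det M *: v))).
  rewrite /N1 !mulr_sumr; apply: ler_sum => i _.
  by rewrite mxE cabs1_lower.
rewrite -mulrA ler_wpM2l ?cabs1_ge0//.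
by rewrite -mul_scalar_mx -mul_adj_mx -mulmxA N1_mulmx.
Qed.

Lemma eucl_cd_sqr v : eucl_cd v ^+ 2 = \sum_i cnormsq (v i 0).
Proof. by rewrite sqr_sqrtr// sumr_ge0// => i _; exact: cnormsq_ge0. Qed.

Lemma eucl_cd_ge0 v : 0 <= eucl_cd v. Proof. exact: sqrtr_ge0. Qed.

Lemma eucl_cd_le_N1 v : eucl_cd v <= N1 v.
Proof.
rewrite -(@ler_pXn2r _ 2)// ?nnegrE ?N1_ge0 ?eucl_cd_ge0// eucl_cd_sqr.
rewrite expr2 [leRHS]mulr_suml ler_sum// => i _.
apply: (@le_trans _ _ (cabs1 (v i 0) ^+ 2)).
  rewrite /cnormsq /cabs1 sqrrD !real_normK ?num_real// addrAC lerDl.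
  by rewrite mulrn_wge0// mulr_ge0.
rewrite expr2 ler_wpM2l ?cabs1_ge0//.
by rewrite /N1 (bigD1 i)//= lerDl sumr_ge0// => k _; exact: cabs1_ge0.
Qed.

Lemma N1_le_eucl_cd v : N1 v <= (2 * d)%:R * eucl_cd v.
Proof.
apply: (@le_trans _ _ (\sum_(i < d) 2 * eucl_cd v)); last first.
  by rewrite sumr_const card_ord natrM -mulrA mulr_natl -mulr_natr; lra.
apply: ler_sum => i _.
have h : cnormsq (v i 0) <= eucl_cd v ^+ 2.
  rewrite eucl_cd_sqr (bigD1 i)//= lerDl sumr_ge0// => k _; exact: cnormsq_ge0.
have h1 (a b : R) : a ^+ 2 + b ^+ 2 <= eucl_cd v ^+ 2 -> `|a| <= eucl_cd v.
  move=> ab; rewrite -(@ler_pXn2r _ 2)// ?nnegrE ?eucl_cd_ge0//.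
  by rewrite real_normK ?num_real// (le_trans _ ab)// lerDl sqr_ge0.
rewrite /cabs1 mulr_natl mulr2n lerD// ?(h1 _ _ h)//.
by rewrite (h1 _ (complex.Re (v i 0)))// addrC.
Qed.

Lemma N1_eq0 v : N1 v = 0 -> v = 0.
Proof.
move=> v0; apply/colP => i; rewrite !mxE; apply: cnormsq_eq0.
have : cnormsq (v i 0) <= eucl_cd v ^+ 2.
  rewrite eucl_cd_sqr (bigD1 i)//= lerDl sumr_ge0// => k _; exact: cnormsq_ge0.
have -> : eucl_cd v = 0.
  by apply/eqP; rewrite eq_le eucl_cd_ge0 andbT -v0 eucl_cd_le_N1.
by rewrite expr0n/= => h; apply/eqP; rewrite eq_le h cnormsq_ge0.
Qed.

Lemma eucl_cd_real (r : R) v : eucl_cd (r%:C *: v) = `|r| * eucl_cd v.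
Proof.
apply/eqP; rewrite -(@eqrXn2 _ 2)// ?mulr_ge0 ?eucl_cd_ge0//.
rewrite exprMn !eucl_cd_sqr mulr_sumr real_normK ?num_real//; apply/eqP.
apply: eq_bigr => i _; rewrite mxE; case: (v i 0) => a b.
by rewrite /cnormsq /= !mul0r subr0 addr0 !exprMn mulrDr.
Qed.

Lemma eucl_cd_opnorm M v : eucl_cd (M *m v) <= opnorm M * eucl_cd v.
Proof.
have [->|v0] := eqVneq v 0.
  have e0 k : eucl_cd (0 : 'cV[R[i]]_k) = 0.
    rewrite /eucl_cd big1 ?sqrtr0// => i _.
    by rewrite mxE /= expr0n/= addr0.
  by rewrite mulmx0 e0 mulr0.
have ev0 : 0 < eucl_cd v.
  rewrite lt_neqAle eucl_cd_ge0 andbT eq_sym; apply: contra v0 => /eqP ev0.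
  apply/eqP/N1_eq0/eqP; rewrite eq_le N1_ge0 andbT.
  by apply: (le_trans (N1_le_eucl_cd v)); rewrite ev0 mulr0.
rewrite -ler_pdivrMr//.
rewrite (_ : _ / _ = eucl_cd (M *m ((eucl_cd v)^-1%:C *: v))); last first.
  by rewrite -scalemxAr eucl_cd_real mulrC gtr0_norm// invr_gt0.
apply: ub_le_sup; last first.
  exists ((eucl_cd v)^-1%:C *: v) => //=.
  by rewrite eucl_cd_real gtr0_norm ?invr_gt0// mulVf// gt_eqF.
(* A real supremum dominates its set only when the set is bounded above; the entrywise l1 bound
   provides this. *)
exists ((\sum_i \sum_j cabs1 (M i j)) * (2 * d)%:R) => _ [u /= u1 <-].
apply: (le_trans (eucl_cd_le_N1 _)); apply: (le_trans (N1_mulmx _ _)).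
rewrite ler_wpM2l//; last by have := N1_le_eucl_cd u; rewrite u1 mulr1.
by apply: sumr_ge0 => i _; apply: sumr_ge0 => j _; exact: cabs1_ge0.
Qed.

Lemma opnorm_ge0 M : 0 <= opnorm M.
Proof.
rewrite /opnorm; set S := [set _ | _ in _].
(* For d = 0 there is no unit vector, and the supremum of the empty set is 0 by convention. *)
have [->|/set0P[_ [v /= v1 _]]] := eqVneq S set0; first by rewrite sup0.
by rewrite (le_trans (eucl_cd_ge0 (M *m v)))// -[leRHS]mulr1 -v1 eucl_cd_opnorm.
Qed.

End vectors.
End complex_l1.

(** * Powers with an exponent between 1 and P *)

Section power_inequalities.
Variables (R : realType) (P p : R).
Hypothesis p1P : 1 <= p <= P.
Implicit Types a b t : R.

Let p1 : 1 <= p. Proof. by case/andP: p1P. Qed.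
Let pP : p <= P. Proof. by case/andP: p1P. Qed.
Let p_ge0 : 0 <= p. Proof. exact: le_trans p1. Qed.

Lemma powR_le_exp a : 1 <= a -> a `^ p <= a `^ P.
Proof. by move=> a1; rewrite ler_powR. Qed.

(** The base 1 + a is at least 1, so its exponent may be raised from p to P. This is the source of
    constants that are uniform in x. *)
Lemma powRM_const_le a t : 0 <= a -> 0 <= t -> (a * t) `^ p <= (1 + a) `^ P * t `^ p.
Proof.
move=> a0 t0; rewrite powRM// ler_wpM2r ?powR_ge0//.
rewrite (@le_trans _ _ ((1 + a) `^ p))//.
  by rewrite ge0_ler_powR ?nnegrE ?addr_ge0// lerDr.
by rewrite powR_le_exp// lerDl.
Qed.

(** The sum is at most twice the larger term, and the factor 2 costs (1 + 2)^P by
    [powRM_const_le]. *)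
Lemma powRD_le a b : 0 <= a -> 0 <= b ->
  (a + b) `^ p <= 3 `^ P * (a `^ p + b `^ p).
Proof.
move=> a0 b0.
have h (x y : R) : 0 <= x -> x <= y -> (x + y) `^ p <= 3 `^ P * y `^ p.
  move=> x0 xy; have y0 := le_trans x0 xy.
  rewrite (_ : 3 = 1 + 2); last by lra.
  apply: (@le_trans _ _ ((2 * y) `^ p)); last by rewrite powRM_const_le.
  by apply: ge0_ler_powR; rewrite ?nnegrE//; lra.
have [ab|/ltW ba] := leP a b.
  by rewrite (le_trans (h _ _ a0 ab))// ler_wpM2l ?powR_ge0// lerDr powR_ge0.
by rewrite addrC (le_trans (h _ _ b0 ba))// ler_wpM2l ?powR_ge0// lerDl powR_ge0.
Qed.

(** Since p >= 1, t <= t^p once t >= 1, and subtracting 1 covers smaller t. Thus a bound on the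
    modular controls the norm itself, uniformly in p. *)
Lemma powR_lower t : 0 <= t -> t - 1 <= t `^ p.
Proof.
move=> t0; have [t1|/ltW t1] := leP t 1.
  by rewrite (@le_trans _ _ 0) ?powR_ge0// subr_le0.
by rewrite (le_trans _ (le1r_powR t1 p1))// gerBl.
Qed.

(** Here t^p <= t because p >= 1 and t <= 1, while a^p is at most 1 or a^P. A small rounding error
    thus enters linearly, with a weight free of p. *)
Lemma powR_small a t : 0 <= a -> 0 <= t <= 1 -> (a * t) `^ p <= (1 + a `^ P) * t.
Proof.
move=> a0 /andP[t0 t1]; rewrite powRM// ler_pM ?powR_ge0//.
  have [a1|/ltW a1] := leP a 1.
    rewrite (@le_trans _ _ 1)//; last by rewrite lerDl powR_ge0.
    by rewrite (le_trans (ge0_ler_powR _ _ _ a1)) ?nnegrE// powR1.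
  by rewrite (le_trans (powR_le_exp a1))// lerDr.
have [->|tn0] := eqVneq t 0; first by rewrite powR0// gt_eqF// (lt_le_trans ltr01).
by rewrite ge1r_powR// t1 andbT lt_neqAle eq_sym tn0.
Qed.

End power_inequalities.

(** * Measurability *)

Section cmeasurable.
Variables (R : realType) (d : measure_display) (T : measurableType d).
Implicit Types f g : T -> R[i].

Definition cmeasurable f :=
  measurable_fun [set: T] (fun t => complex.Re (f t)) /\
  measurable_fun [set: T] (fun t => complex.Im (f t)).

Lemma cmeasurable_cst (c : R[i]) : cmeasurable (fun=> c).
Proof. by split; exact: measurable_cst. Qed.

Lemma cmeasurableD f g : cmeasurable f -> cmeasurable g ->
  cmeasurable (fun t => f t + g t).
Proof.
move=> [fr fi] [gr gi]; split.
  apply: (@eq_measurable_fun _ _ _ _ _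
    ((fun t => complex.Re (f t)) \+ (fun t => complex.Re (g t)))).
    by move=> t _ /=; case: (f t) (g t) => ? ? [? ?].
  exact: measurable_funD.
apply: (@eq_measurable_fun _ _ _ _ _
  ((fun t => complex.Im (f t)) \+ (fun t => complex.Im (g t)))).
  by move=> t _ /=; case: (f t) (g t) => ? ? [? ?].
exact: measurable_funD.
Qed.

Lemma cmeasurableM f g : cmeasurable f -> cmeasurable g ->
  cmeasurable (fun t => f t * g t).
Proof.
move=> [fr fi] [gr gi]; split.
  apply: (@eq_measurable_fun _ _ _ _ _
    (((fun t => complex.Re (f t)) \* (fun t => complex.Re (g t))) \-
     ((fun t => complex.Im (f t)) \* (fun t => complex.Im (g t))))).
    by move=> t _ /=; case: (f t) (g t) => ? ? [? ?].
  by apply: measurable_funB; exact: measurable_funM.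
apply: (@eq_measurable_fun _ _ _ _ _
    (((fun t => complex.Re (f t)) \* (fun t => complex.Im (g t))) \+
     ((fun t => complex.Im (f t)) \* (fun t => complex.Re (g t))))).
  by move=> t _ /=; case: (f t) (g t) => ? ? [? ?].
by apply: measurable_funD; exact: measurable_funM.
Qed.

Lemma cmeasurableB f g : cmeasurable f -> cmeasurable g ->
  cmeasurable (fun t => f t - g t).
Proof.
move=> mf mg; have := cmeasurableD mf (cmeasurableM (cmeasurable_cst (-1)) mg).
by congr cmeasurable; apply/funext => t; rewrite mulN1r.
Qed.

Lemma cmeasurable_sum I (s : seq I) (P : pred I) (h : I -> T -> R[i]) :
  (forall i, cmeasurable (h i)) ->
  cmeasurable (fun t => \sum_(i <- s | P i) h i t).
Proof.
move=> mh; elim: s => [|a s IH].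
  under eq_fun do rewrite big_nil; exact: cmeasurable_cst.
under eq_fun do rewrite big_cons.
by case: (P a) => //; exact: cmeasurableD.
Qed.

Lemma cmeasurable_prod I (s : seq I) (P : pred I) (h : I -> T -> R[i]) :
  (forall i, cmeasurable (h i)) ->
  cmeasurable (fun t => \prod_(i <- s | P i) h i t).
Proof.
move=> mh; elim: s => [|a s IH].
  under eq_fun do rewrite big_nil; exact: cmeasurable_cst.
under eq_fun do rewrite big_cons.
by case: (P a) => //; exact: cmeasurableM.
Qed.

Definition mx_cmeasurable m k (M : T -> 'M[R[i]]_(m, k)) :=
  forall i j, cmeasurable (fun t => M t i j).

Lemma mx_cmeasurable_mul m k l (M : T -> 'M[R[i]]_(m, k)) (N : T -> 'M[R[i]]_(k, l)) :
  mx_cmeasurable M -> mx_cmeasurable N -> mx_cmeasurable (fun t => M t *m N t).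
Proof.
move=> mM mN i j; under eq_fun do rewrite mxE.
by apply: cmeasurable_sum => k'; exact: cmeasurableM.
Qed.

Lemma mx_cmeasurableB m k (M N : T -> 'M[R[i]]_(m, k)) :
  mx_cmeasurable M -> mx_cmeasurable N -> mx_cmeasurable (fun t => M t - N t).
Proof.
move=> mM mN i j; under eq_fun do rewrite !mxE.
exact: cmeasurableB.
Qed.

Lemma cmeasurable_det k (M : T -> 'M[R[i]]_k) :
  mx_cmeasurable M -> cmeasurable (fun t => \det (M t)).
Proof.
move=> mM; apply: cmeasurable_sum => s.
by apply: cmeasurableM; [exact: cmeasurable_cst|exact: cmeasurable_prod].
Qed.

Lemma mx_cmeasurable_adj k (M : T -> 'M[R[i]]_k) :
  mx_cmeasurable M -> mx_cmeasurable (fun t => \adj (M t)).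
Proof.
move=> mM i j; under eq_fun do rewrite mxE.
apply: cmeasurableM; first exact: cmeasurable_cst.
by apply: cmeasurable_det => a b; under eq_fun do rewrite !mxE; exact: mM.
Qed.

Lemma measurable_cabs1 f : cmeasurable f ->
  measurable_fun [set: T] (fun t => cabs1 (f t)).
Proof.
by move=> [fr fi]; apply: measurable_funD; exact: measurableT_comp.
Qed.

Lemma measurable_cnormsq f : cmeasurable f ->
  measurable_fun [set: T] (fun t => cnormsq (f t)).
Proof.
by move=> [fr fi]; apply: measurable_funD; exact: measurable_funX.
Qed.

Lemma measurable_N1 k (v : T -> 'cV[R[i]]_k) : mx_cmeasurable v ->
  measurable_fun [set: T] (fun t => N1 (v t)).
Proof. by move=> mv; apply: measurable_sum => i; exact: measurable_cabs1. Qed.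

(** Off the zeros of the base, the power is the exponential of g ln f. Measurability in both
    arguments matters because the exponent varies with x. *)
Lemma measurable_powR2 (f g : T -> R) :
  measurable_fun [set: T] f -> measurable_fun [set: T] g ->
  measurable_fun [set: T] (fun t => f t `^ g t).
Proof.
move=> mf mg; rewrite /powR; apply: measurable_fun_ifT.
- exact: measurable_fun_eqr.
- apply: (@eq_measurable_fun _ _ _ _ _ (fun t => if g t == 0 then 1 else 0 : R)).
    by move=> t _; case: (g t == 0).
  by apply: measurable_fun_ifT => //; exact: measurable_fun_eqr.
- apply: measurableT_comp; first exact: measurable_expR.
  by apply: measurable_funM => //; apply: measurableT_comp => //; exact: measurable_ln.
Qed.

End cmeasurable.

Lemma mx_cmeasurable_comp (R : realType) d1 d2 (T1 : measurableType d1)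
    (T2 : measurableType d2) m k (M : T2 -> 'M[R[i]]_(m, k)) (h : T1 -> T2) :
  measurable_fun [set: T1] h -> mx_cmeasurable M -> mx_cmeasurable (fun t => M (h t)).
Proof.
move=> mh mM i j; have [mr mi] := mM i j.
by split; [exact: (measurableT_comp mr mh)|exact: (measurableT_comp mi mh)].
Qed.

(** * Integrals of non-negative real functions, and Tonelli *)

Section nonneg_real_integral.
Variables (R : realType) (d : measure_display) (T : measurableType d).
Variable mu : {measure set T -> \bar R}.
Implicit Types h k : T -> R.
Local Open Scope ereal_scope.

Lemma integral_EFin_le h k : measurable_fun [set: T] h -> measurable_fun [set: T] k ->
  (forall x, 0 <= h x)%R -> (forall x, h x <= k x)%R ->
  \int[mu]_x (h x)%:E <= \int[mu]_x (k x)%:E.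
Proof.
move=> mh mk h0 hk; apply: ge0_le_integral => //.
- by move=> x _; rewrite lee_fin.
- exact/measurable_EFinP.
- exact/measurable_EFinP.
- by move=> x _; rewrite lee_fin.
Qed.

Lemma integral_EFinD h k : measurable_fun [set: T] h -> measurable_fun [set: T] k ->
  (forall x, 0 <= h x)%R -> (forall x, 0 <= k x)%R ->
  \int[mu]_x (h x + k x)%:E = \int[mu]_x (h x)%:E + \int[mu]_x (k x)%:E.
Proof.
move=> mh mk h0 k0; under eq_integral do rewrite EFinD.
apply: ge0_integralD => //.
- by move=> x _; rewrite lee_fin.
- exact/measurable_EFinP.
- by move=> x _; rewrite lee_fin.
- exact/measurable_EFinP.
Qed.

Lemma integral_EFinZ (c : R) h : measurable_fun [set: T] h ->
  (forall x, 0 <= h x)%R -> (0 <= c)%R ->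
  \int[mu]_x (c * h x)%:E = c%:E * \int[mu]_x (h x)%:E.
Proof.
move=> mh h0 c0; under eq_integral do rewrite EFinM.
apply: ge0_integralZl_EFin => //.
- by move=> x _; rewrite lee_fin.
- exact/measurable_EFinP.
Qed.

Lemma integral_EFin_indic (A : set T) : measurable A ->
  \int[mu]_x (\1_A x)%:E = mu A.
Proof. by move=> mA; rewrite integral_indic// setIT. Qed.

Lemma integral_EFin_ge0 h : (forall x, 0 <= h x)%R -> 0 <= \int[mu]_x (h x)%:E.
Proof. by move=> h0; apply: integral_ge0 => x _; rewrite lee_fin. Qed.

End nonneg_real_integral.

Section tonelli_EFin.
Variables (R : realType) (d1 d2 : measure_display).
Variables (T1 : measurableType d1) (T2 : measurableType d2).
Variables (m1 : {sigma_finite_measure set T1 -> \bar R}).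
Variables (m2 : {sigma_finite_measure set T2 -> \bar R}).
Variable h : T1 -> T2 -> R.
Hypothesis mh : measurable_fun [set: T1 * T2] (fun xy => h xy.1 xy.2).
Hypothesis h0 : forall x y, 0 <= h x y.

Let f (xy : T1 * T2) : \bar R := (h xy.1 xy.2)%:E.
Let mf : measurable_fun [set: T1 * T2] f. Proof. exact/measurable_EFinP. Qed.
Let f0 xy : (0 <= f xy)%E. Proof. by rewrite lee_fin. Qed.

Lemma measurable_integral_l :
  measurable_fun [set: T2] (fun y => \int[m1]_x (h x y)%:E)%E.
Proof. exact: (@measurable_fun_fubini_tonelli_G _ _ _ _ _ m1 f). Qed.

Lemma measurable_integral_r :
  measurable_fun [set: T1] (fun x => \int[m2]_y (h x y)%:E)%E.
Proof. exact: (@measurable_fun_fubini_tonelli_F _ _ _ _ _ m2 f). Qed.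

Lemma tonelli_EFin :
  (\int[m1]_x \int[m2]_y (h x y)%:E = \int[m2]_y \int[m1]_x (h x y)%:E)%E.
Proof. exact: (@fubini_tonelli _ _ _ _ _ m1 m2 f). Qed.

End tonelli_EFin.

(** * Sampling on cubes *)

Section weighted_power.
Variables (R : realType) (n d : nat).
Variables (W : 'rV[R]_n -> 'M[R[i]]_d) (p : 'rV[R]_n -> R) (P : R).
Hypothesis mW : @mx_cmeasurable R _ (borel_space R n) d d W.
Hypothesis mp : measurable_fun [set: borel_space R n] p.
Hypothesis p1P : forall x, 1 <= p x <= P.

Definition Phi (x : 'rV[R]_n) (v : 'cV[R[i]]_d) : R := N1 (W x *m v) `^ p x.

Lemma Phi_ge0 x v : 0 <= Phi x v. Proof. exact: powR_ge0. Qed.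

Lemma PhiN x v : Phi x (- v) = Phi x v.
Proof. by rewrite /Phi mulmxN N1N. Qed.

Lemma PhiD x u v : Phi x (u + v) <= 3 `^ P * (Phi x u + Phi x v).
Proof.
rewrite /Phi mulmxDr (le_trans _ (powRD_le (p1P x) _ _)) ?N1_ge0//.
have /andP[p1 _] := p1P x.
by rewrite ge0_ler_powR ?nnegrE ?addr_ge0 ?N1_ge0 ?N1D// (le_trans _ p1).
Qed.

Lemma PhiB x u v w : Phi x (u - w) <= 3 `^ P * (Phi x (u - v) + Phi x (v - w)).
Proof. by rewrite -(subrKA v) PhiD. Qed.

Lemma measurable_Phi d0 (T : measurableType d0) (a : T -> 'rV[R]_n)
    (u : T -> 'cV[R[i]]_d) :
  measurable_fun [set: T] (a : T -> borel_space R n) -> mx_cmeasurable u ->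
  measurable_fun [set: T] (fun t => Phi (a t) (u t)).
Proof.
move=> ma mu; apply: measurable_powR2; last exact: (measurableT_comp mp ma).
apply: measurable_N1; apply: mx_cmeasurable_mul => //.
exact: (mx_cmeasurable_comp ma mW).
Qed.

Section integrals.
Variable mu : {sigma_finite_measure set (borel_space R n) -> \bar R}.
Hypothesis muE : represents_intB mu.
Implicit Types f : 'rV[R]_n -> 'cV[R[i]]_d.

Definition borel_vfun f := @mx_cmeasurable R _ (borel_space R n) d 1 f.

Lemma measurable_Phi_id f : borel_vfun f ->
  measurable_fun [set: borel_space R n] (fun x => Phi x (f x)).
Proof.
move=> mf; apply: (@measurable_Phi _ (borel_space R n) id f) => //.
Qed.

Lemma measurable_sub_indic (A : set (borel_space R n)) : measurable A ->
  measurable_fun [set: borel_space R n] (\1_A : 'rV[R]_n -> R).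
Proof. exact: measurable_indic. Qed.

Lemma integral_cube (a b : R) : a <= b ->
  (\int[mu]_x (\1_(cube a b : set 'rV[R]_n) x)%:E = ((b - a) ^+ n)%:E)%E.
Proof.
move=> ab; rewrite integral_EFin_indic; last exact: measurable_cube.
exact: measure_cube.
Qed.

Definition lattice_pt (l : R) (x : 'rV[R]_n) : 'rV[R]_n :=
  \row_i (l * (Num.floor (x 0 i / l))%:~R).

Lemma measurable_lattice_pt l :
  measurable_fun [set: borel_space R n] (lattice_pt l : _ -> borel_space R n).
Proof.
apply: measurable_row => i.
apply: (@eq_measurable_fun _ _ (borel_space R n) _ _
  (fun x : 'rV[R]_n => l * (Num.floor (x 0 i / l))%:~R)).
  by move=> x _; rewrite mxE.
apply: measurable_funM; first exact: measurable_cst.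
have mfl : measurable_fun [set: measurableTypeR R] (fun t : R => (Num.floor t)%:~R : R).
  apply: nondecreasing_measurable => // s t st.
  by rewrite ler_int le_floor.
apply: (measurableT_comp mfl).
by apply: measurable_funM; [exact: measurable_coord|exact: measurable_cst].
Qed.

Lemma lattice_pt_sub l x : 0 < l -> cube 0 l (x - lattice_pt l x).
Proof.
move=> l0 i; rewrite !mxE.
have /andP[h1 h2] := floor_itv (x 0 i / l).
rewrite ler_pdivlMr// in h1; rewrite ltr_pdivrMr// intrD mulrDl mul1r in h2.
by rewrite subr_ge0 ltrBlDl mulrC h1/= h2.
Qed.

(** If every offset failed, the double integral over s in [0, l)^n would be at least 2^(n+1) e l^n,
    whereas the change of variables bounds it by e (2l)^n. The exponent n+1 in place of n makes the
    contradiction strict. *)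
Lemma sample_exists f (l e : R) : borel_vfun f -> 0 < l -> 0 < e ->
  (forall y : 'rV[R]_n, (forall i, `|y 0 i| <= l) ->
     (\int[mu]_x (Phi x (f (x + y) - f x))%:E <= e%:E)%E) ->
  exists s : 'rV[R]_n,
    (\int[mu]_x (Phi x (f (lattice_pt l x + s) - f x))%:E <= (2 ^+ n.+1 * e)%:E)%E.
Proof.
move=> mf l0 e0 fe; apply: contrapT => /forallNP hs.
(* [h] and [k] are hidden behind equations to keep unification from
   unfolding them. *)
have [h hE] : {h : 'rV[R]_n -> 'rV[R]_n -> R | h = fun x s =>
    \1_(cube 0 l) s * Phi x (f (lattice_pt l x + s) - f x)} by eexists; exact: erefl.
have [k kE] : {k : 'rV[R]_n -> 'rV[R]_n -> R | k = fun x y =>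
    \1_(cube (- l) l) y * Phi x (f (x + y) - f x)} by eexists; exact: erefl.
have h0 x s : 0 <= h x s by rewrite hE mulr_ge0 ?Phi_ge0.
have k0 x y : 0 <= k x y by rewrite kE mulr_ge0 ?Phi_ge0.
have m1 := @measurable_fst _ _ (borel_space R n) (borel_space R n).
have m2 := @measurable_snd _ _ (borel_space R n) (borel_space R n).
have mh : measurable_fun [set: borel_space R n * borel_space R n] (fun xs => h xs.1 xs.2).
  rewrite hE.
  apply: measurable_funM.
    exact: (measurableT_comp (measurable_sub_indic (measurable_cube 0 l)) m2).
  apply: measurable_Phi => //; apply: mx_cmeasurableB.
    apply: mx_cmeasurable_comp mf; apply: measurable_addrow => //.
    exact: (measurableT_comp (@measurable_lattice_pt l) m1).
  exact: mx_cmeasurable_comp m1 mf.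
have mk : measurable_fun [set: borel_space R n * borel_space R n] (fun xs => k xs.1 xs.2).
  rewrite kE.
  apply: measurable_funM.
    exact: (measurableT_comp (measurable_sub_indic (measurable_cube (- l) l)) m2).
  apply: measurable_Phi => //; apply: mx_cmeasurableB.
    by apply: mx_cmeasurable_comp mf; exact: measurable_addrow.
  exact: mx_cmeasurable_comp m1 mf.
have lower : ((2 ^+ n.+1 * e * l ^+ n)%:E <= \int[mu]_s \int[mu]_x (h x s)%:E)%E.
  rewrite (_ : (_ * l ^+ n)%:E = \int[mu]_s (2 ^+ n.+1 * e * \1_(cube 0 l) s)%:E)%E; last first.
    rewrite integral_EFinZ// ?mulr_ge0// ?ltW//; last first.
      exact: (measurable_sub_indic (measurable_cube _ _)).
    by rewrite integral_cube ?subr0// ltW.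
  apply: ge0_le_integral => //=.
  - by move=> s _; rewrite lee_fin !mulr_ge0// ltW.
  - apply/measurable_EFinP/measurable_funM => //.
    exact: (measurable_sub_indic (measurable_cube _ _)).
  - have mI := @measurable_integral_l _ _ _
      (borel_space R n) (borel_space R n) mu _ mh h0.
    exact: mI.
  move=> s _; rewrite hE indicE; case: (s \in _); last first.
    by rewrite mulr0 integral_EFin_ge0// => x; rewrite mul0r.
  rewrite mulr1; under eq_integral do rewrite mul1r.
  by have /negP := hs s; rewrite -ltNge => /ltW.
have upper : (\int[mu]_y \int[mu]_x (k x y)%:E <= (e * (2 * l) ^+ n)%:E)%E.
  rewrite (_ : (e * _)%:E = \int[mu]_y (e * \1_(cube (- l) l) y)%:E)%E; last first.
    rewrite integral_EFinZ//; last 2 first.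
    - exact: (measurable_sub_indic (measurable_cube _ _)).
    - exact: ltW.
    rewrite integral_cube; last by lra.
    by rewrite opprK (_ : l + l = 2 * l); last by ring.
  apply: ge0_le_integral => //=.
  - by move=> y _; apply: integral_ge0 => x _; rewrite lee_fin; exact: k0.
  - have mI := @measurable_integral_l _ _ _
      (borel_space R n) (borel_space R n) mu _ mk k0.
    exact: mI.
  - apply/measurable_EFinP/measurable_funM => //.
    exact: (measurable_sub_indic (measurable_cube _ _)).
  move=> y _; rewrite kE indicE; case: (boolP (y \in _)) => [/set_mem yl|_].
    rewrite mulr1; under eq_integral do rewrite mul1r.
    by apply: fe => i; have /andP[h1 h2] := yl i; rewrite ler_norml h1 ltW.
  by rewrite mulr0; under eq_integral do rewrite mul0r; rewrite integral0.
(* Substitute y = s - (x - [lattice_pt l x]): both terms lie in [0, l)^n, so y lies in [-l, l)^n. *)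
have inner x : (\int[mu]_s (h x s)%:E <= \int[mu]_y (k x y)%:E)%E.
  have mkx : measurable_fun [set: borel_space R n] (fun y => (k x y)%:E).
    apply/measurable_EFinP.
    exact: (measurableT_comp mk (@pair1_measurable _ _ (borel_space R n) (borel_space R n) x)).
  have k0x y : (0 <= (k x y)%:E)%E by rewrite lee_fin; exact: k0.
  rewrite -(ge0_integral_translation muE (lattice_pt l x - x) mkx k0x).
  apply: ge0_le_integral => //=.
  - by move=> s _; rewrite lee_fin; exact: h0.
  - apply/measurable_EFinP.
    exact: (measurableT_comp mh (@pair1_measurable _ _ (borel_space R n) (borel_space R n) x)).
  - apply: (measurableT_comp mkx); apply: (@measurable_addrow R n _ (borel_space R n)).
      exact: measurable_id.
    exact: (@measurable_cst _ _ _ (borel_space R n)).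
  move=> s _; rewrite lee_fin hE kE.
  rewrite (_ : x + (s + (lattice_pt l x - x)) = lattice_pt l x + s); last first.
    by rewrite addrCA [x + _]addrC subrK addrC.
  rewrite !indicE; case: (boolP (s \in _)) => [/set_mem sl|_].
    rewrite mem_set// => i; have := lattice_pt_sub x l0 i.
    by have := sl i; rewrite !mxE => /andP[? ?] /andP[? ?]; lra.
  by rewrite mul0r mulr_ge0 ?Phi_ge0.
(* Tonelli brings the integral in x outside, where the bound [inner], valid for each x, can be
   integrated. *)
have : ((2 ^+ n.+1 * e * l ^+ n)%:E <= (e * (2 * l) ^+ n)%:E)%E.
  apply: (le_trans lower); apply: le_trans upper.
  rewrite -(@tonelli_EFin _ _ _ (borel_space R n) (borel_space R n) mu mu _ mh h0).
  rewrite -(@tonelli_EFin _ _ _ (borel_space R n) (borel_space R n) mu mu _ mk k0).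
  apply: ge0_le_integral => //=.
  - by move=> y _; apply: integral_ge0 => s _; rewrite lee_fin; exact: h0.
  - have mI := @measurable_integral_r _ _ _
      (borel_space R n) (borel_space R n) mu _ mh h0.
    exact: mI.
  - have mI := @measurable_integral_r _ _ _
      (borel_space R n) (borel_space R n) mu _ mk k0.
    exact: mI.
rewrite lee_fin exprMn exprS => hle.
have : 0 < e * (2 ^+ n * l ^+ n) by rewrite !mulr_gt0 ?exprn_gt0.
by move: hle; rewrite mulrCA; lra.
Qed.

End integrals.
End weighted_power.

(** * Finite codes *)

(** Each real coordinate, lying in [-V, V], is replaced by the index of its interval in a grid of
    step s; a code records these finitely many indices. *)
Lemma bounded_code (R : realType) (d : nat) (J : finType) (V e : R) : 0 < e ->
  exists (Gam : finType) (code : (J -> 'cV[R[i]]_d) -> Gam),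
    forall v w, (forall j, N1 (v j) <= V) -> (forall j, N1 (w j) <= V) ->
      code v = code w -> forall j, N1 (v j - w j) <= e.
Proof.
(* The 2d real coordinates differ by at most s each, in total e d/(d+1) <= e; d+1 keeps the
   denominator nonzero when d = 0. *)
move=> e0; pose s : R := e / (2 * d.+1%:R).
have s0 : 0 < s by rewrite divr_gt0// mulr_gt0.
pose m := Num.trunc (2 * V / s).
pose idx (t : R) : 'I_m.+1 := inord (Num.trunc ((t + V) / s)).
have idxP t u : `|t| <= V -> `|u| <= V -> idx t = idx u -> `|t - u| <= s.
  move=> tV uV.
  have bound w : `|w| <= V -> (Num.trunc ((w + V) / s) < m.+1)%N.
    rewrite ler_norml => /andP[w1 w2]; rewrite ltnS; apply: le_truncn.
    by rewrite ler_pM2r ?invr_gt0//; lra.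
  have itv w : `|w| <= V ->
      s * (Num.trunc ((w + V) / s))%:R <= w + V < s * (Num.trunc ((w + V) / s)).+1%:R.
    rewrite ler_norml => /andP[w1 w2].
    have /truncn_itv/andP[h1 h2] : 0 <= (w + V) / s by apply: divr_ge0; [lra|exact: ltW].
    by rewrite ler_pdivlMr// in h1; rewrite ltr_pdivrMr// in h2; rewrite mulrC h1 mulrC h2.
  move=> /(congr1 (@nat_of_ord _)); rewrite /idx !inordK ?bound// => tu.
  have /andP[t1 t2] := itv _ tV; have /andP[u1 u2] := itv _ uV.
  rewrite -tu -natr1 mulrDr mulr1 in u1 u2; rewrite -natr1 mulrDr mulr1 in t2.
  by rewrite ler_norml; apply/andP; split; lra.
exists {ffun J * 'I_d * bool -> 'I_m.+1}, (fun v => [ffun a =>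
  idx (if a.2 then complex.Re (v a.1.1 a.1.2 0) else complex.Im (v a.1.1 a.1.2 0))]).
move=> v w vV wV vw j.
have N1b (u : 'cV[R[i]]_d) i : N1 u <= V ->
    `|complex.Re (u i 0)| <= V /\ `|complex.Im (u i 0)| <= V.
  rewrite /N1 (bigD1 i)//= => uV.
  have h : 0 <= \sum_(k < d | k != i) cabs1 (u k 0).
    by apply: sumr_ge0 => k _; exact: cabs1_ge0.
  have h2 := normr_ge0 (complex.Re (u i 0)); have h3 := normr_ge0 (complex.Im (u i 0)).
  by rewrite /cabs1 in uV; split; lra.
apply: (@le_trans _ _ (\sum_(i < d) (2 * s))).
  apply: ler_sum => i _.
  have [v1 v2] := N1b _ i (vV j); have [w1 w2] := N1b _ i (wV j).
  have := congr1 (fun f : {ffun _ -> _} => f (j, i, true)) vw.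
  rewrite !ffunE /= => /(idxP _ _ v1 w1) h1.
  have := congr1 (fun f : {ffun _ -> _} => f (j, i, false)) vw.
  rewrite !ffunE /= => /(idxP _ _ v2 w2) h2.
  rewrite !mxE /cabs1; move: h1 h2; case: (v j i 0) (w j i 0) => [a b] [a' b'] /=.
  by lra.
rewrite sumr_const card_ord.
rewrite (_ : 2 * s *+ d = e * (d%:R / d.+1%:R)); last first.
  rewrite -[LHS]mulr_natr /s.
  have : d.+1%:R != 0 :> R by rewrite pnatr_eq0.
  by move: (d.+1%:R : R) => D D0; field.
apply: ler_piMr; first exact: ltW.
by rewrite ler_pdivrMr ?ltr0n// mul1r ler_nat.
Qed.

(** * Balls and lattice cells in R^n *)

Lemma measurable_eball0 (R : realType) n (r : R) :
  measurable (eball0 r : set (borel_space R n)).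
Proof.
have m : measurable_fun [set: borel_space R n] (fun x : 'rV[R]_n => eucl_rn x).
  apply: (measurableT_comp (continuous_measurable_fun (@sqrt_continuous R))).
  by apply: measurable_sum => i; apply: measurable_funX; exact: measurable_coord.
have := measurable_fun_ltr m (measurable_cst r) measurableT (_ : measurable [set true]).
move=> /(_ I); rewrite setTI.
by congr measurable; apply/seteqP; split => x.
Qed.

Lemma normr_coord_le_eucl (R : realType) n (x : 'rV[R]_n) i : `|x 0 i| <= eucl_rn x.
Proof.
rewrite -sqrtr_sqr ler_wsqrtr// (bigD1 i)//= lerDl sumr_ge0// => j _.
exact: sqr_ge0.
Qed.

Lemma eucl_rn_le (R : realType) n (x : 'rV[R]_n) (l : R) : 0 <= l ->
  (forall i, `|x 0 i| <= l) -> eucl_rn x <= n%:R * l.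
Proof.
move=> l0 xl; case: n x xl => [|n] x xl.
  by rewrite /eucl_rn big_ord0 sqrtr0 mul0r.
rewrite -[leRHS]ger0_norm ?mulr_ge0// -sqrtr_sqr ler_wsqrtr//.
apply: (@le_trans _ _ (\sum_(i < n.+1) l ^+ 2)).
  apply: ler_sum => i _.
  by rewrite -(real_normK (num_real (x 0 i))) ler_pXn2r ?nnegrE.
rewrite sumr_const card_ord exprMn -[leLHS]mulr_natl ler_wpM2r ?sqr_ge0//.
by rewrite -natrX ler_nat expnS expn1 leq_pmull.
Qed.

Lemma lattice_pt_eq (R : realType) n (l : R) (k : 'I_n -> int) (x : 'rV[R]_n) :
  0 < l -> cube 0 l (x - \row_i (l * (k i)%:~R)) ->
  lattice_pt l x = \row_i (l * (k i)%:~R).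
Proof.
move=> l0 xc; apply/rowP => i; rewrite !mxE; congr (_ * _%:~R).
have := xc i; rewrite !mxE subr_ge0 => /andP[h1 h2].
apply: floor_def; rewrite ler_pdivlMr// ltr_pdivrMr// intrD mulrDl mul1r.
by rewrite mulrC h1/=; lra.
Qed.

(** The integers floor(x_i / l) lie in [-m, m]; adding m indexes them by 0, ..., 2m. Hence a bounded
    region meets finitely many cells. *)
Lemma lattice_pt_bounded (R : realType) n (l : R) (m : nat) (x : 'rV[R]_n) :
  0 < l -> (forall i, `|x 0 i| <= l * m%:R) ->
  exists j : {ffun 'I_n -> 'I_(2 * m).+1},
    lattice_pt l x = \row_i (l * ((j i : nat)%:Z - m%:Z)%:~R).
Proof.
move=> l0 xm; exists [ffun i => inord (absz (Num.floor (x 0 i / l) + m%:Z))].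
apply/rowP => i; rewrite !mxE ffunE; congr (_ * _%:~R).
have := xm i; rewrite ler_norml => /andP[h1 h2].
have h3 : - m%:Z <= Num.floor (x 0 i / l).
  by rewrite floor_ge_int intrN ler_pdivlMr// mulNr mulrC.
have h4 : Num.floor (x 0 i / l) <= m%:Z.
  rewrite -(@ler_int R) (le_trans (floor_le _))// ler_pdivrMr// mulrC.
  exact: h2.
by rewrite inordK; lia.
Qed.

(** * Coercivity on a cube *)

Section core.
Variables (R : realType) (n d : nat).
Variables (W : 'rV[R]_n -> 'M[R[i]]_d) (p : 'rV[R]_n -> R) (P : R).
Hypothesis mW : @mx_cmeasurable R _ (borel_space R n) d d W.
Hypothesis mp : measurable_fun [set: borel_space R n] p.
Hypothesis p1P : forall x, 1 <= p x <= P.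
Variable mu : {sigma_finite_measure set (borel_space R n) -> \bar R}.
Hypothesis muE : represents_intB mu.
Hypothesis detW : {ae mu, forall x, \det (W x) != 0}.
Local Notation Phi := (Phi W p).

Lemma measurable_Phi_cst v :
  measurable_fun [set: borel_space R n] (fun x => Phi x v).
Proof.
apply: (measurable_Phi_id mW mp) => i j; exact: cmeasurable_cst.
Qed.

(* The sets [E k], on which [N1 v <= k * N1 (W x *m v)] by Cramer's rule,
   exhaust [A] up to a null set, so one of them has positive measure. *)
Lemma Phi_coercive (A : set (borel_space R n)) (M : R) : measurable A ->
  mu A != 0%E -> (mu A < +oo)%E ->
  exists V : R, forall v,
    (\int[mu]_x (\1_A x * Phi x v)%:E <= M%:E)%E -> N1 v <= V.
Proof.
move=> mA A0 Aoo.
pose S (x : 'rV[R]_n) := \sum_i \sum_j cabs1 ((\adj (W x)) i j).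
have S0 x : 0 <= S x.
  by apply: sumr_ge0 => i _; apply: sumr_ge0 => j _; exact: cabs1_ge0.
(* The summand 1 forces det(W x) to be nonzero on [E k], so that [cnormsq] of it can be cancelled
   below. *)
pose E (k : nat) : set (borel_space R n) := A `&`
  [set x | 1 + cabs1 (\det (W x)) * S x <= k%:R * cnormsq (\det (W x))].
have mdet := cmeasurable_det mW.
have mS : measurable_fun [set: borel_space R n] S.
  apply: measurable_sum => i; apply: measurable_sum => j.
  exact: measurable_cabs1 (mx_cmeasurable_adj mW i j).
have mE k : measurable (E k).
  have mf : measurable_fun [set: borel_space R n]
      (fun x => 1 + cabs1 (\det (W x)) * S x).
    apply: measurable_funD; first exact: measurable_cst.
    by apply: measurable_funM => //; exact: measurable_cabs1.
  have mg : measurable_fun [set: borel_space R n]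
      (fun x => k%:R * cnormsq (\det (W x))).
    by apply: measurable_funM; [exact: measurable_cst|exact: measurable_cnormsq].
  have := measurable_fun_ler mf mg measurableT (_ : measurable [set true]).
  move=> /(_ I) mfg; rewrite setTI in mfg; exact: measurableI.
have [k Ek0] : exists k, mu (E k) != 0%E.
  apply: contrapT => /forallNP Ek0; move/negP: A0; apply; apply/eqP.
  apply/negligibleP => //.
  have [Z [mZ Z0 detZ]] := detW.
  apply: (@negligibleS _ _ _ _ (Z `|` \bigcup_k E k)); last first.
    apply: negligibleU; first exact/negligibleP.
    apply: negligible_bigcup => k; apply/negligibleP => //.
    by apply/eqP/negPn/negP; exact: Ek0.
  move=> x Ax; have [Zx|Zx] := pselect (Z x); [by left|right].
  have dx : \det (W x) != 0 by apply: contrapT => dx; apply: Zx; exact: detZ.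
  have nx : 0 < cnormsq (\det (W x)).
    rewrite lt_neqAle cnormsq_ge0 andbT eq_sym; apply: contra dx => /eqP.
    by move=> /cnormsq_eq0 ->.
  exists (Num.trunc ((1 + cabs1 (\det (W x)) * S x) / cnormsq (\det (W x)))).+1 => //.
  split => //=; rewrite -ler_pdivrMr//; apply: ltW; exact: truncnS_gt.
have Ekoo : (mu (E k) < +oo)%E.
  apply: le_lt_trans Aoo; apply: le_measure; rewrite ?inE//; exact: subIsetl.
have [e e0 Eke] : exists2 e : R, 0 < e & mu (E k) = e%:E.
  have Efin : mu (E k) \is a fin_num by rewrite ge0_fin_numE.
  exists (fine (mu (E k))); last by rewrite fineK.
  by rewrite fine_gt0// Ekoo andbT lt0e Ek0 measure_ge0.
have mEk := mE k.
(* On [E k], N1 v <= k (Phi x v + 1); integrating over this set of measure e gives e N1 v <= k (M +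
   e). *)
exists (k%:R * (M + e) / e) => v vM.
rewrite ler_pdivlMr//.
have mPhi := measurable_Phi_cst v.
have mind (B : set (borel_space R n)) : measurable B ->
  measurable_fun [set: borel_space R n] (\1_B : 'rV[R]_n -> R).
  by move=> mB; exact: measurable_indic.
have mAPhi : measurable_fun [set: borel_space R n] (fun x => \1_A x * Phi x v).
  by apply: measurable_funM => //; exact: mind.
have h1 x : 0 <= \1_A x * Phi x v by rewrite mulr_ge0// Phi_ge0.
have i1 : (\int[mu]_x (\1_(E k) x)%:E = e%:E)%E.
  by rewrite integral_EFin_indic.
rewrite -lee_fin EFinM -i1 -integral_EFinZ//; last exact: N1_ge0.
apply: (@le_trans _ _ (\int[mu]_x (k%:R * (\1_A x * Phi x v + \1_(E k) x))%:E)%E).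
  apply: (@integral_EFin_le _ _ (borel_space R n) mu).
  - by apply: measurable_funM => //; exact: mind.
  - apply: measurable_funM; first exact: measurable_cst.
    by apply: measurable_funD => //; exact: mind.
  - by move=> x; rewrite mulr_ge0// N1_ge0.
  move=> x; rewrite !indicE; case: (boolP (x \in E k)) => [/set_mem[Ax /= Ex]|_]; last first.
    by rewrite mulr0 addr0 mulr_ge0// mulr_ge0// Phi_ge0.
  rewrite mem_set//= mul1r mulr1.
  set D := \det (W x) in Ex.
  have D0 : 0 < k%:R * cnormsq D.
    by rewrite (lt_le_trans _ Ex)// (lt_le_trans ltr01)// lerDl mulr_ge0 ?cabs1_ge0.
  have {}D0 : 0 < cnormsq D.
    rewrite lt_neqAle cnormsq_ge0 andbT; apply: contraTneq D0 => <-.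
    by rewrite mulr0 ltxx.
  apply: (@le_trans _ _ (k%:R * N1 (W x *m v))).
    rewrite -(ler_pM2l D0) (le_trans (N1_det_lower _ _))//.
    rewrite mulrA ler_wpM2r ?N1_ge0// [_ * k%:R]mulrC (le_trans _ Ex)//.
    by rewrite lerDr.
  by rewrite ler_wpM2l// -lerBlDr; apply: (powR_lower (p1P x)); exact: N1_ge0.
rewrite integral_EFinZ//; last 2 first.
- by apply: measurable_funD => //; exact: mind.
- by move=> x; rewrite addr_ge0.
rewrite integral_EFinD//.
by rewrite i1 EFinM EFinD lee_wpmul2l// leeD2r.
Qed.

Lemma cube_translate_measurable (l : R) (c : 'rV[R]_n) :
  measurable ([set x | cube 0 l (x - c)] : set (borel_space R n)).
Proof.
rewrite -[X in measurable X]setTI.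
apply: (@measurable_addrow R n _ (borel_space R n) id (fun=> - c)) => //.
exact: measurable_cube.
Qed.

Lemma measure_cube_translate (l : R) (c : 'rV[R]_n) : 0 <= l ->
  mu [set x | cube 0 l (x - c)] = (l ^+ n)%:E.
Proof.
move=> l0; have mc := cube_translate_measurable l c.
rewrite -[LHS](integral_EFin_indic mu mc).
rewrite -[in RHS](subr0 l) -(integral_cube muE l0).
rewrite -[RHS](ge0_integral_translation muE (- c)).
- by [].
- exact: (measurable_EFin_indic (measurable_cube _ _)).
- by move=> x; rewrite lee_fin.
Qed.

End core.

(** * Pointwise comparison of two sampled functions *)

Lemma quasi_triangle3 (R : realFieldType) (C a a' E X Y Z : R) : 1 <= C ->
  0 <= a -> 0 <= E -> X <= C * (a + Y) -> Y <= C * (Z + a') -> Z <= E ->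
  X <= C ^+ 2 * (a + a') + C ^+ 2 * E.
Proof.
move=> C1 a0 E0 hX hY hZ; have C0 : 0 <= C := le_trans ler01 C1.
apply: (le_trans hX); apply: (@le_trans _ _ (C * (a + C * (E + a')))).
  apply: ler_wpM2l => //; apply: lerD => //; apply: (le_trans hY).
  by apply: ler_wpM2l => //; exact: lerD.
rewrite (_ : _ + _ = C * (C * a + C * (E + a'))); last by ring.
by apply: ler_wpM2l => //; apply: lerD => //; exact: ler_peMl.
Qed.

Section net.
Variables (R : realType) (n d : nat).
Variables (W : 'rV[R]_n -> 'M[R[i]]_d) (p : 'rV[R]_n -> R) (P : R).
Hypothesis mW : @mx_cmeasurable R _ (borel_space R n) d d W.
Hypothesis mp : measurable_fun [set: borel_space R n] p.
Hypothesis p1P : forall x, 1 <= p x <= P.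
Local Notation Phi := (Phi W p).
Implicit Types f : 'rV[R]_n -> 'cV[R[i]]_d.

Definition cell_osc f (l : R) (s x : 'rV[R]_n) : R :=
  Phi x (f (lattice_pt l x + s) - f x).

Lemma cell_osc_ge0 f l s x : 0 <= cell_osc f l s x.
Proof. exact: Phi_ge0. Qed.

Lemma measurable_lattice_val f l s : borel_vfun f ->
  borel_vfun (fun x => f (lattice_pt l x + s)).
Proof.
move=> mf; apply: (@mx_cmeasurable_comp _ _ _ (borel_space R n)
  (borel_space R n) _ _ f (fun x => lattice_pt l x + s)) => //.
apply: (@measurable_addrow R n _ (borel_space R n) _ (fun=> s)).
  exact: measurable_lattice_pt.
exact: (@measurable_cst _ _ _ (borel_space R n)).
Qed.

Lemma measurable_cell_osc f l s : borel_vfun f ->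
  measurable_fun [set: borel_space R n] (cell_osc f l s).
Proof.
move=> mf; apply: (measurable_Phi_id mW mp); apply: mx_cmeasurableB => //.
exact: measurable_lattice_val.
Qed.

(** The sampled values u and v are inserted between f x and g x by two quasi-triangle inequalities.
    The outer differences are sampling errors; the middle one is the rounding error, small enough
    for the linear bound on [Phi]. *)
Lemma net_pointwise f g l s t (B : 'rV[R]_n -> R) e x : 1 <= P ->
  (forall v, N1 v <= 1 -> Phi x v <= N1 v * B x) -> 0 <= B x -> e <= 1 ->
  N1 (f (lattice_pt l x + s) - g (lattice_pt l x + t)) <= e ->
  Phi x (f x - g x) <=
    (3 `^ P) ^+ 2 * (cell_osc f l s x + cell_osc g l t x) + (3 `^ P) ^+ 2 * (e * B x).
Proof.
move=> P1 Phi_small B0 e1 fge; set C := 3 `^ P.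
have C1 : 1 <= C by rewrite -(powRr0 3) ler_powR// ?ler1n// (le_trans _ P1).
have C0 : 0 <= C := le_trans ler01 C1.
set u := f (lattice_pt l x + s) in fge *; set v := g (lattice_pt l x + t) in fge *.
have h1 : Phi x (f x - g x) <= C * (Phi x (f x - u) + Phi x (u - g x)).
  exact: (PhiB W p1P).
have h2 : Phi x (u - g x) <= C * (Phi x (u - v) + Phi x (v - g x)).
  exact: (PhiB W p1P).
have h3 : Phi x (u - v) <= e * B x.
  by rewrite (le_trans (Phi_small _ (le_trans fge e1)))// ler_wpM2r.
have h4 : Phi x (f x - u) = cell_osc f l s x.
  by rewrite -opprB PhiN.
rewrite h4 in h1.
have h5 : Phi x (v - g x) = cell_osc g l t x by exact: erefl.
rewrite h5 in h2.
apply: (quasi_triangle3 C1 (cell_osc_ge0 f l s x) _ h1 h2 h3).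
exact: mulr_ge0 (le_trans (N1_ge0 _) fge) B0.
Qed.

End net.

(** * Functions with the same code *)

Section core_net.
Variables (R : realType) (n d : nat).
Variables (W : 'rV[R]_n -> 'M[R[i]]_d) (p : 'rV[R]_n -> R) (P : R).
Hypothesis mW : @mx_cmeasurable R _ (borel_space R n) d d W.
Hypothesis mp : measurable_fun [set: borel_space R n] p.
Hypothesis p1P : forall x, 1 <= p x <= P.
Variable mu : {sigma_finite_measure set (borel_space R n) -> \bar R}.
Hypothesis muE : represents_intB mu.
Hypothesis detW : {ae mu, forall x, \det (W x) != 0}.
Local Notation Phi := (Phi W p).
Implicit Types f : 'rV[R]_n -> 'cV[R[i]]_d.

(** On one cell the sampled function is a constant vector, whose modular there is controlled by the
    sampling error and the modular of f. Coercivity then bounds the vector by a [V] independent of f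
    and s. *)
Lemma lattice_values_bounded (l : R) (M e : R) (j : 'I_n -> int) : 0 < l ->
  exists V : R, forall f s, borel_vfun f ->
    (\int[mu]_x (Phi x (f x))%:E <= M%:E)%E ->
    (\int[mu]_x (cell_osc W p f l s x)%:E <= e%:E)%E ->
    N1 (f (\row_i (l * (j i)%:~R) + s)) <= V.
Proof.
move=> l0; set c := \row_i (l * (j i)%:~R).
have mA := cube_translate_measurable l c.
have muA := measure_cube_translate muE c (ltW l0).
set A := [set x : 'rV[R]_n | cube 0 l (x - c)] in mA muA.
have A0 : mu A != 0%E by rewrite muA eqe gt_eqF// exprn_gt0.
have Aoo : (mu A < +oo)%E by rewrite muA ltry.
have [V hV] := Phi_coercive mW mp p1P detW (3 `^ P * (e + M)) mA A0 Aoo.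
exists V => f s mf fM fe; apply: hV.
have mosc := measurable_cell_osc mW mp l s mf.
have mPhi := measurable_Phi_id mW mp mf.
have osc0 := cell_osc_ge0 W p f l s.
have Phi0 x : 0 <= Phi x (f x) by exact: Phi_ge0.
apply: (@le_trans _ _
  (\int[mu]_x (3 `^ P * (cell_osc W p f l s x + Phi x (f x)))%:E)%E).
  apply: (@integral_EFin_le _ _ (borel_space R n) mu).
  - apply: measurable_funM; first exact: measurable_indic.
    exact: measurable_Phi_cst.
  - apply: measurable_funM; first exact: measurable_cst.
    exact: measurable_funD.
  - by move=> x; rewrite mulr_ge0// Phi_ge0.
  move=> x; rewrite indicE; case: (boolP (x \in _)) => [/set_mem /= Ax|_].
    rewrite mul1r /c -(lattice_pt_eq l0 Ax).
    by rewrite -[X in Phi x X](subrK (f x)) (PhiD W p1P).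
  by rewrite mul0r mulr_ge0 ?powR_ge0// addr_ge0.
rewrite integral_EFinZ ?powR_ge0//; last 2 first.
- exact: measurable_funD.
- by move=> x; rewrite addr_ge0.
by rewrite integral_EFinD// EFinM EFinD lee_wpmul2l ?lee_fin ?powR_ge0// leeD.
Qed.

(** The bound eta is shared equally among three errors: sampling, rounding inside the ball of radius
    r, and the tails outside it. Inside the ball the codes are compared; outside, f and g are simply
    estimated separately. *)
Lemma core_net (G : set ('rV[R]_n -> 'cV[R[i]]_d)) (B : 'rV[R]_n -> R) (M eta : R) :
  (forall f, G f -> borel_vfun f) ->
  measurable_fun [set: borel_space R n] B -> (forall x, 0 <= B x) ->
  (forall x v, N1 v <= 1 -> Phi x v <= N1 v * B x) ->
  (forall r, \int[mu]_x (\1_(eball0 r) x * B x)%:E < +oo)%E ->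
  (forall f, G f -> \int[mu]_x (Phi x (f x))%:E <= M%:E)%E ->
  (forall e, 0 < e -> exists r, forall f, G f ->
    (\int[mu]_x (\1_(~` eball0 r) x * Phi x (f x))%:E <= e%:E)%E) ->
  (forall e, 0 < e -> exists2 r, 0 < r & forall f, G f -> forall y : 'rV[R]_n,
    (forall i, `|y 0 i| <= r) ->
    (\int[mu]_x (Phi x (f (x + y) - f x))%:E <= e%:E)%E) ->
  0 < eta ->
  exists (Gam : finType) (rel : ('rV[R]_n -> 'cV[R[i]]_d) -> Gam -> Prop),
    (forall f, G f -> exists c, rel f c) /\
    (forall f g c, G f -> G g -> rel f c -> rel g c ->
      \int[mu]_x (Phi x (f x - g x))%:E <= eta%:E)%E.
Proof.
move=> mG mB B0 BP Bint GM Gtail Gtrans eta0.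
have P1 : 1 <= P by have /andP[p1 pP] := p1P 0; exact: le_trans pP.
set C := 3 `^ P.
have C1 : 1 <= C by rewrite -(powRr0 3) ler_powR// ?ler1n// (le_trans _ P1).
have C0 : 0 < C := lt_le_trans ltr01 C1.
(* Two tails, each multiplied by C, add up to eta / 3. *)
have [r hr] := Gtail (eta / (6 * C)) (divr_gt0 eta0 (mulr_gt0 (ltr0Sn R 5) C0)).
have [b b0 hb] : exists2 b : R, 0 <= b &
    (\int[mu]_x (\1_(eball0 r) x * B x)%:E = b%:E)%E.
  have i0 : (0 <= \int[mu]_x (\1_(eball0 r) x * B x)%:E)%E.
    by apply: integral_ge0 => x _; rewrite lee_fin mulr_ge0.
  exists (fine (\int[mu]_x (\1_(eball0 r) x * B x)%:E)); first exact: fine_ge0.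
  by rewrite fineK// ge0_fin_numE.
(* The cap 1 keeps rounding errors in the range of the linear bound on [Phi]; b + 1 avoids dividing
   by a vanishing b. *)
pose e := Num.min 1 (eta / (3 * C ^+ 2 * (b + 1))).
have e0 : 0 < e.
  rewrite lt_min ltr01 divr_gt0// !mulr_gt0 ?exprn_gt0//.
  by apply: (lt_le_trans ltr01); rewrite lerDr.
(* Sampling costs a factor 2^(n+1), occurs for both f and g, and is multiplied by C^2: in total eta
   / 3. *)
pose e2 := eta / (6 * C ^+ 2 * 2 ^+ n.+1).
have e20 : 0 < e2 by rewrite divr_gt0// !mulr_gt0 ?exprn_gt0.
have [l l0 hl] := Gtrans e2 e20.
(* Chosen so that the cells with corner indices in [-m, m]^n cover the ball of radius r. *)
pose m := (Num.trunc (r / l)).+1.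
have rm : r <= l * m%:R by rewrite mulrC -ler_pdivrMr// ltW// truncnS_gt.
pose J : finType := {ffun 'I_n -> 'I_(2 * m).+1}.
pose pt (j : J) : 'rV[R]_n := \row_i (l * ((j i : nat)%:Z - m%:Z)%:~R).
have [V_ hV_] := choice (fun j : J =>
  lattice_values_bounded M (2 ^+ n.+1 * e2) (fun i => (j i : nat)%:Z - m%:Z) l0).
(* A common bound for the values on all finitely many cells. *)
pose V := \sum_j `|V_ j|.
have [Gam [code hcode]] := @bounded_code R d J V e e0.
exists Gam, (fun f c => exists2 s,
  (\int[mu]_x (cell_osc W p f l s x)%:E <= (2 ^+ n.+1 * e2)%:E)%E &
  code (fun j => f (pt j + s)) = c).
split=> [f Gf|f g c Gf Gg [s fs fc] [t gt gc]].
  have [s hs] := sample_exists mW mp muE (mG f Gf) l0 e20 (hl f Gf).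
  by exists (code (fun j => f (pt j + s))), s.
have bV f' s' : G f' ->
    (\int[mu]_x (cell_osc W p f' l s' x)%:E <= (2 ^+ n.+1 * e2)%:E)%E ->
    forall j, N1 (f' (pt j + s')) <= V.
  move=> Gf' fs' j; rewrite (le_trans (hV_ j f' s' (mG _ Gf') (GM _ Gf') fs'))//.
  rewrite (le_trans (ler_norm _))// /V (bigD1 j)//= lerDl sumr_ge0//.
have close := hcode _ _ (bV f s Gf fs) (bV g t Gg gt) (etrans fc (esym gc)).
have mf := mG f Gf; have mg := mG g Gg.
have moscf := measurable_cell_osc mW mp l s mf.
have moscg := measurable_cell_osc mW mp l t mg.
have oscf0 := cell_osc_ge0 W p f l s.
have oscg0 := cell_osc_ge0 W p g l t.
have mball : measurable_fun [set: borel_space R n] (\1_(eball0 r) : 'rV[R]_n -> R).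
  exact: (measurable_sub_indic (measurable_eball0 r)).
have mballC : measurable_fun [set: borel_space R n] (\1_(~` eball0 r) : 'rV[R]_n -> R).
  exact: (measurable_sub_indic (measurableC (measurable_eball0 r))).
pose k1 x : R := cell_osc W p f l s x + cell_osc W p g l t x.
pose k2 x : R := \1_(eball0 r) x * B x.
pose k3 x : R := \1_(~` eball0 r) x * Phi x (f x) + \1_(~` eball0 r) x * Phi x (g x).
have mk1 : measurable_fun [set: borel_space R n] k1.
  exact: (measurable_funD moscf moscg).
have mk2 : measurable_fun [set: borel_space R n] k2.
  exact: (measurable_funM mball mB).
have mk3f : measurable_fun [set: borel_space R n] (fun x => \1_(~` eball0 r) x * Phi x (f x)).
  exact: (measurable_funM mballC (measurable_Phi_id mW mp mf)).
have mk3g : measurable_fun [set: borel_space R n] (fun x => \1_(~` eball0 r) x * Phi x (g x)).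
  exact: (measurable_funM mballC (measurable_Phi_id mW mp mg)).
have mk3 : measurable_fun [set: borel_space R n] k3.
  exact: (measurable_funD mk3f mk3g).
have indic0 (A : set 'rV[R]_n) x : 0 <= \1_A x :> R by rewrite indicE ler0n.
have k10 x : 0 <= k1 x := addr_ge0 (oscf0 x) (oscg0 x).
have k20 x : 0 <= k2 x := mulr_ge0 (indic0 _ x) (B0 x).
have k3f0 x : 0 <= \1_(~` eball0 r) x * Phi x (f x)
  := mulr_ge0 (indic0 _ x) (Phi_ge0 W p x (f x)).
have k3g0 x : 0 <= \1_(~` eball0 r) x * Phi x (g x)
  := mulr_ge0 (indic0 _ x) (Phi_ge0 W p x (g x)).
have k30 x : 0 <= k3 x := addr_ge0 (k3f0 x) (k3g0 x).
have ptw x : Phi x (f x - g x) <= C ^+ 2 * k1 x + (C ^+ 2 * e * k2 x + C * k3 x).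
  rewrite /k1 /k2 /k3 !indicE in_setC.
  case: (boolP (x \in eball0 r)) => [/set_mem /= xr|_] /=; last first.
    rewrite !mul1r mul0r mulr0 add0r.
    apply: (@le_trans _ _ (C * (Phi x (f x) + Phi x (g x)))).
      by rewrite -(PhiN W p x (g x)); exact: (PhiD W p1P).
    by rewrite lerDr; exact: (mulr_ge0 (exprn_ge0 2 (ltW C0)) (addr_ge0 (oscf0 x) (oscg0 x))).
  rewrite mul1r !mul0r addr0 mulr0 addr0 -mulrA.
  have [j hj] : exists j : J, lattice_pt l x = pt j.
    apply: lattice_pt_bounded => // i; apply: (le_trans _ rm).
    exact: (le_trans (normr_coord_le_eucl x i) (ltW xr)).
  apply: (net_pointwise p1P P1 (BP x) (B0 x)).
    by rewrite ge_min lexx.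
  by rewrite hj; exact: close.
have i1 : (\int[mu]_x (k1 x)%:E <= (2 * (2 ^+ n.+1 * e2))%:E)%E.
  rewrite (integral_EFinD mu moscf moscg oscf0 oscg0).
  by rewrite mulr_natl mulr2n EFinD; exact: (leeD fs gt).
have i3 : (\int[mu]_x (k3 x)%:E <= (2 * (eta / (6 * C)))%:E)%E.
  rewrite (integral_EFinD mu mk3f mk3g k3f0 k3g0).
  by rewrite mulr_natl mulr2n EFinD; exact: (leeD (hr f Gf) (hr g Gg)).
have mfg := measurable_Phi_id mW mp (mx_cmeasurableB mf mg).
clear bV close hcode hV_ hr hl fs gt fc gc.
have C20 : 0 <= C ^+ 2 by exact: exprn_ge0 (ltW C0).
have C2e0 : 0 <= C ^+ 2 * e by exact: mulr_ge0 C20 (ltW e0).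
have mC (z : R) (h : 'rV[R]_n -> R) : measurable_fun [set: borel_space R n] h ->
  measurable_fun [set: borel_space R n] (fun x => z * h x).
  by move=> mh; exact: (measurable_funM (measurable_cst z) mh).
have n1 x : 0 <= C ^+ 2 * k1 x := mulr_ge0 C20 (k10 x).
have n2 x : 0 <= C ^+ 2 * e * k2 x := mulr_ge0 C2e0 (k20 x).
have n3 x : 0 <= C * k3 x := mulr_ge0 (ltW C0) (k30 x).
have n23 x : 0 <= C ^+ 2 * e * k2 x + C * k3 x := addr_ge0 (n2 x) (n3 x).
have m23 : measurable_fun [set: borel_space R n]
    (fun x => C ^+ 2 * e * k2 x + C * k3 x).
  exact: (measurable_funD (mC _ _ mk2) (mC _ _ mk3)).
apply: (@le_trans _ _
  (\int[mu]_x (C ^+ 2 * k1 x + (C ^+ 2 * e * k2 x + C * k3 x))%:E)%E).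
  apply: (@integral_EFin_le _ _ (borel_space R n) mu _ _ mfg _ _ ptw).
    exact: (measurable_funD (mC _ _ mk1) m23).
  by move=> x; exact: Phi_ge0.
rewrite (integral_EFinD mu (mC _ _ mk1) m23 n1 n23).
rewrite (integral_EFinD mu (mC _ _ mk2) (mC _ _ mk3) n2 n3).
rewrite (integral_EFinZ mu mk1 k10 C20) (integral_EFinZ mu mk2 k20 C2e0).
rewrite (integral_EFinZ mu mk3 k30 (ltW C0)) hb.
apply: (@le_trans _ _ ((C ^+ 2)%:E * (2 * (2 ^+ n.+1 * e2))%:E +
  ((C ^+ 2 * e)%:E * b%:E + C%:E * (2 * (eta / (6 * C)))%:E))%E).
  apply: leeD; first by rewrite lee_wpmul2l// lee_fin.
  by apply: leeD => //; rewrite lee_wpmul2l// lee_fin ltW.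
rewrite -!EFinM -!EFinD lee_fin.
have C_neq0 : C != 0 by rewrite gt_eqF.
have p2_neq0 : (2 : R) ^+ n.+1 != 0 by rewrite gt_eqF// exprn_gt0.
have b1_gt0 : 0 < b + 1 by apply: (lt_le_trans ltr01); rewrite lerDr.
have -> : C ^+ 2 * (2 * (2 ^+ n.+1 * e2)) = eta / 3.
  by rewrite /e2; field; rewrite p2_neq0 C_neq0.
have -> : C * (2 * (eta / (6 * C))) = eta / 3 by field.
have : C ^+ 2 * e * b <= eta / 3.
  apply: (@le_trans _ _ (C ^+ 2 * (eta / (3 * C ^+ 2 * (b + 1))) * (b + 1))).
    apply: ler_pM => //; last by rewrite lerDl.
    by rewrite ler_wpM2l// ge_min lexx orbT.
  rewrite le_eqVlt; apply/orP; left; apply/eqP; field.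
  by rewrite C_neq0 gt_eqF.
by lra.
Qed.

End core_net.

(** * Borel versions and almost everywhere bounds *)

Section almost_everywhere.
Variables (R : realType) (dsp : measure_display) (T : measurableType dsp).
Variable mu : {measure set T -> \bar R}.

Lemma ae_mono2 (P Q S : T -> Prop) : (forall x, P x -> Q x -> S x) ->
  {ae mu, forall x, P x} -> {ae mu, forall x, Q x} -> {ae mu, forall x, S x}.
Proof.
move=> PQS hP hQ; apply: negligibleS (negligibleU hP hQ) => x nS.
by apply: contrapT => /not_orP[/contrapT Px /contrapT Qx]; apply: nS; exact: PQS.
Qed.

Lemma negligible_countable_bigcup (I : countType) (A : I -> set T) :
  (forall i, mu.-negligible (A i)) -> mu.-negligible (\bigcup_i A i).
Proof.
move=> nA.
apply: (@negligibleS _ _ _ _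
    (\bigcup_k (if (unpickle k : option I) is Some i then A i else set0))).
  by move=> x [i _ Aix]; exists (pickle i) => //; rewrite pickleK.
apply: negligible_bigcup => k.
by case: unpickle => [i|]; [exact: nA|exact: negligible_set0].
Qed.

Lemma measurable_fun_off (Z : set T) (g : T -> R) (c : R) : measurable Z ->
  measurable_fun (~` Z) g ->
  measurable_fun [set: T] (fun x => if x \in Z then c else g x).
Proof.
move=> mZ mg; apply: measurable_fun_if => //.
  apply: (@measurable_fun_bool _ _ _ _ true).
  by rewrite setTI (_ : _ @^-1` _ = Z)//; apply/seteqP; split => x; [exact: set_mem|exact: mem_set].
apply: measurable_funS mg; first exact: measurableC.
by move=> x [_ /= /negbT]; rewrite notin_setE.
Qed.

End almost_everywhere.

Section bridge.
Variables (R : realType) (n : nat).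
Variable mu : {sigma_finite_measure set (borel_space R n) -> \bar R}.
Hypothesis muE : represents_intB mu.

Lemma lmeas_family (I : countType) (g : I -> 'rV[R]_n -> R) :
  (forall i, lmeas_rfun (g i)) ->
  exists Z : set (borel_space R n), [/\ measurable Z, mu Z = 0%E &
    forall i, measurable_fun (~` Z : set (borel_space R n)) (g i)].
Proof.
move=> mg; have [Z_ hZ] := choice (fun i => lmeas_rfun_measurable muE (mg i)).
have nZ : mu.-negligible (\bigcup_i Z_ i).
  apply: negligible_countable_bigcup => i; have [mZ Z0 _] := hZ i.
  exact/negligibleP.
have [Z [mZ Z0 ZZ]] := nZ; exists Z; split => // i.
have [mZi _ mgi] := hZ i; apply: measurable_funS mgi; first exact: measurableC.
by apply: subsetC => x Zx; apply: ZZ; exists i.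
Qed.

(** Lets the almost everywhere equality of f with its Borel version pass to the translates of f. *)
Lemma negligible_translation (y : 'rV[R]_n) (A : set 'rV[R]_n) :
  mu.-negligible A -> mu.-negligible [set x | A (x + y)].
Proof.
move=> [Z [mZ Z0 AZ]].
have mZy : measurable ([set x | Z (x + y)] : set (borel_space R n)).
  rewrite -[X in measurable X]setTI.
  by apply: (@measurable_addrow R n _ (borel_space R n) id (fun=> y)).
exists [set x | Z (x + y)]; split => //; last by move=> x; exact: AZ.
rewrite -[LHS](integral_EFin_indic mu mZy) -Z0 -[RHS](integral_EFin_indic mu mZ).
rewrite -[RHS](ge0_integral_translation muE y).
- by [].
- exact: (measurable_EFin_indic mZ).
- by move=> x; rewrite lee_fin.
Qed.

Lemma measure_setT_neq0 : mu [set: borel_space R n] != 0%E.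
Proof.
have mc : measurable (cube 0 1 : set (borel_space R n)) by exact: measurable_cube.
apply/negP => /eqP T0.
have : (mu (cube 0 1 : set 'rV[R]_n) <= mu [set: borel_space R n])%E.
  by apply: le_measure; rewrite ?inE.
by rewrite (measure_cube muE ler01) subr0 expr1n T0 lee_fin ler10.
Qed.

(** R^n is not a null set, since the unit cube has measure 1, so a bound valid almost everywhere
    holds at some point. In particular the essential supremum is not -oo, and [fine] returns its
    true value when it is finite. *)
Lemma ess_sup_rn_ge1 (p : 'rV[R]_n -> \bar R) : (forall x, 1 <= p x)%E ->
  (1 <= ess_sup_rn p)%E.
Proof.
move=> p1; apply: le_ereal_inf_tmp => M /= /(ae_rnP muE) pM.
rewrite leNgt; apply/negP => M1; have /negP := measure_setT_neq0; apply; apply/eqP.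
apply/negligibleP => //; apply: negligibleS pM => x _ /= /(le_lt_trans)/(_ M1).
by rewrite ltNge p1.
Qed.

(** The infimum is attained: the points where p exceeds it form the countable union of the null sets
    where p exceeds it by more than 1/(k+1). *)
Lemma ess_sup_rn_ae (p : 'rV[R]_n -> \bar R) : (forall x, 1 <= p x)%E ->
  (ess_sup_rn p < +oo)%E ->
  {ae mu, forall x, (p x <= (fine (ess_sup_rn p))%:E)%E}.
Proof.
move=> p1 poo; have p1' := ess_sup_rn_ge1 p1.
have pfin : ess_sup_rn p \is a fin_num.
  by rewrite ge0_fin_numE// (le_trans _ p1').
set P := fine _; have PE : ess_sup_rn p = P%:E by rewrite fineK.
pose U (k : nat) : set (borel_space R n) :=
  [set x : 'rV[R]_n | ~ (p x <= (P + k.+1%:R^-1)%R%:E)%E].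
have : mu.-negligible (\bigcup_k U k); last first.
  apply: negligibleS => x /= px; apply: contrapT => hx; apply: px; apply/lee_addgt0Pr => e e0.
  have [k _ hk] := near_infty_natSinv_lt (PosNum e0).
  have {}hk : k.+1%:R^-1 < e by apply: (hk k) => /=.
  apply: contrapT => pe; apply: hx; exists k => //= pk; apply: pe.
  by rewrite (le_trans pk)// -EFinD lee_fin lerD2l ltW.
apply: negligible_bigcup => k.
have : (ess_sup_rn p < (P + k.+1%:R^-1)%:E)%E.
  by rewrite PE lte_fin ltrDl invr_gt0 ltr0n.
move=> /ereal_inf_lt[M /= /(ae_rnP muE) pM Mk].
by apply: negligibleS pM => x /= hx pxM; apply: hx; exact: (le_trans pxM (ltW Mk)).
Qed.

(** Carries hypotheses on the outer integral over to Borel functions. The constant is moved onto the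
    measurable [h], whose integral is homogeneous. *)
Lemma integral_le_of_lint (h : 'rV[R]_n -> R) (phi : 'rV[R]_n -> \bar R) (D m : R) :
  0 < D -> measurable_fun [set: borel_space R n] h -> (forall x, 0 <= h x) ->
  (forall x, 0 <= phi x)%E ->
  {ae mu, forall x, ((h x)%:E <= D%:E * phi x)%E} ->
  (lint phi <= m%:E)%E -> (\int[mu]_x (h x)%:E <= (D * m)%:E)%E.
Proof.
move=> D0 mh h0 phi0 hphi lm.
have mDh : measurable_fun [set: borel_space R n] (fun x => D^-1 * h x).
  exact: (measurable_funM (measurable_cst _) mh).
have Dh0 x : 0 <= D^-1 * h x by rewrite mulr_ge0// invr_ge0 ltW.
have : (\int[mu]_x (D^-1 * h x)%:E <= m%:E)%E.
  apply: le_trans lm; apply: (integral_le_lint muE) => //.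
    exact/measurable_EFinP.
  apply: negligibleS hphi => x /= hx hD; apply: hx.
  by rewrite EFinM lee_pdivrMl.
have Di0 : 0 <= D^-1 by rewrite invr_ge0 ltW.
rewrite integral_EFinZ//.
by rewrite lee_pdivrMl// EFinM.
Qed.

Lemma borel_version (d : nat) (f : 'rV[R]_n -> 'cV[R[i]]_d) : lmeas_cfun f ->
  exists2 g : 'rV[R]_n -> 'cV[R[i]]_d, borel_vfun g &
    {ae mu, forall x, f x = g x}.
Proof.
move=> mf.
pose c (ib : 'I_d * bool) x :=
  if ib.2 then complex.Re (f x ib.1 0) else complex.Im (f x ib.1 0).
have [Z [mZ Z0 hZ]] : exists Z : set (borel_space R n), [/\ measurable Z, mu Z = 0%E &
    forall ib, measurable_fun (~` Z : set (borel_space R n)) (c ib)].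
  by apply: lmeas_family => -[i []]; [exact: (mf i).1|exact: (mf i).2].
exists (fun x => if x \in Z then 0 else f x); last first.
  exists Z; split => // x /= fx; apply: contrapT => Zx; apply: fx.
  by rewrite ifN// notin_setE.
move=> i j; rewrite (ord1 j); split.
  apply: (eq_measurable_fun _ _ (measurable_fun_off 0 mZ (hZ (i, true)))).
  by move=> x _; case: ifP => _ //; rewrite mxE.
apply: (eq_measurable_fun _ _ (measurable_fun_off 0 mZ (hZ (i, false)))).
by move=> x _; case: ifP => _ //; rewrite mxE.
Qed.

End bridge.

(** For each code choose a member of F having it, or a fixed member of F if there is none; an empty
    F gets the empty net. *)
Lemma finite_choice_net (A : Type) (F : set A) (Gam : finType) (rel : A -> Gam -> Prop) :
  (forall f, F f -> exists c, rel f c) ->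
  exists (k : nat) (g : 'I_k -> A), (forall j, F (g j)) /\
    forall f, F f -> exists j c, rel f c /\ rel (g j) c.
Proof.
move=> hrel; have [[f0 Ff0]|F0] := pselect (exists f, F f); last first.
  exists 0%N, (fun j : 'I_0 => False_rect A (notF (ltn_ord j))).
  split=> [[]//|f Ff]; exfalso; apply: F0; by exists f.
have h_ c : exists f, F f /\ ((exists2 f', F f' & rel f' c) -> rel f c).
  have [[f Ff fc]|nf] := pselect (exists2 f', F f' & rel f' c); first by exists f.
  by exists f0; split => // -[f' Ff' f'c]; exfalso; apply: nf; exists f'.
have [h hh] := choice h_.
exists #|Gam|, (fun j => h (enum_val j)); split=> [j|f Ff]; first by case: (hh (enum_val j)).
have [c fc] := hrel f Ff; exists (enum_rank c), c; split => //.
by rewrite enum_rankK; have [_] := hh c; apply; exists f.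
Qed.

(** * Borel versions of the exponent and the weight *)

Section borel_data.
Variables (R : realType) (n d : nat).
Variable mu : {sigma_finite_measure set (borel_space R n) -> \bar R}.
Hypothesis muE : represents_intB mu.
Variables (p : 'rV[R]_n -> \bar R) (W : 'rV[R]_n -> 'M[R[i]]_d).
Hypothesis p_meas : lmeas_efun p.
Hypothesis p1 : forall x, (1 <= p x)%E.
Hypothesis p_bounded : (ess_sup_rn p < +oo)%E.
Hypothesis W_weight : inv_matrix_weight W.
Let P := fine (ess_sup_rn p).
Hypothesis W_int : L1loc (fun x => opnorm (W x) `^ P).

Lemma lmeas_fine : lmeas_rfun (fun x => fine (p x)).
Proof.
move=> B mB; apply: (p_meas (B := fine @^-1` B)).
by rewrite -[X in measurable X]setTI; exact: (@fine_measurable R setT).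
Qed.

(** All defects are collected in one Borel null set, on which the data receive harmless values
    (exponent 1, matrix 0), so that the bounds on [q] and the linear bound on [Phi] hold at every
    point. *)
Lemma borel_exponent_weight :
  exists (q : 'rV[R]_n -> R) (V : 'rV[R]_n -> 'M[R[i]]_d) (beta : 'rV[R]_n -> R),
  [/\ [/\ measurable_fun [set: borel_space R n] q, forall x, 1 <= q x <= P &
          {ae mu, forall x, p x = (q x)%:E}],
      [/\ @mx_cmeasurable R _ (borel_space R n) d d V,
          {ae mu, forall x, \det (V x) != 0} & {ae mu, forall x, W x = V x}],
      measurable_fun [set: borel_space R n] beta,
      (forall x, 0 <= beta x /\ forall v, N1 v <= 1 -> Phi V q x v <= N1 v * beta x) &
      (forall r, \int[mu]_x (\1_(eball0 r) x * beta x)%:E < +oo)%E].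
Proof.
have [mW _ _ dW] := W_weight; have [mO iO] := W_int.
have P1 : 1 <= P.
  have h1 := ess_sup_rn_ge1 muE p1.
  by rewrite -lee_fin fineK// ge0_fin_numE// (le_trans _ h1).
have [Z1 [mZ1 Z10 pZ1]] := ess_sup_rn_ae muE p1 p_bounded.
have /(ae_rnP muE)[Z2 [mZ2 Z20 dZ2]] := dW.
have [Zp [mZp Zp0 hZp]] := lmeas_rfun_measurable muE lmeas_fine.
have [ZO [mZO ZO0 hZO]] := lmeas_rfun_measurable muE mO.
pose c (ib : 'I_d * 'I_d * bool) x :=
  if ib.2 then complex.Re (W x ib.1.1 ib.1.2) else complex.Im (W x ib.1.1 ib.1.2).
have [ZW [mZW ZW0 hZW]] : exists Z : set (borel_space R n), [/\ measurable Z, mu Z = 0%E &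
    forall ib, measurable_fun (~` Z : set (borel_space R n)) (c ib)].
  by apply: (lmeas_family muE) => -[[i j] []]; [exact: (mW i j).1|exact: (mW i j).2].
(* In order: p exceeds P, W is singular, and the exceptional sets for the measurability of p, of the
   power of the operator norm, and of the entries of W. *)
pose Z : set (borel_space R n) := Z1 `|` Z2 `|` Zp `|` ZO `|` ZW.
have mZ : measurable Z by do 4![apply: measurableU => //].
have nZ : mu.-negligible Z.
  by do 4![apply: negligibleU; last exact/negligibleP]; exact/negligibleP.
have ZS (U : set (borel_space R n)) (g : 'rV[R]_n -> R) (z : R) :
    measurable U -> U `<=` Z -> measurable_fun (~` U : set (borel_space R n)) g ->
    measurable_fun [set: borel_space R n] (fun x => if x \in Z then z else g x).
  move=> mU UZ mg; apply: measurable_fun_off => //.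
  by apply: measurable_funS mg; [exact: measurableC|exact: subsetC].
have aeZ (S : 'rV[R]_n -> Prop) : (forall x, ~ Z x -> S x) -> {ae mu, forall x, S x}.
  by move=> ZSx; apply: negligibleS nZ => x /= nS; apply: contrapT => /ZSx.
have pZ x : ~ Z x -> p x = (fine (p x))%:E /\ 1 <= fine (p x) <= P.
  move=> Zx; have pP : (p x <= P%:E)%E.
    by apply: contrapT => pP; apply: Zx; do 4!left; exact: pZ1.
  have pfin : p x \is a fin_num.
    by rewrite ge0_fin_numE ?(le_trans _ (p1 x))// (le_lt_trans pP)// ltry.
  by split; [rewrite fineK|rewrite -!lee_fin fineK// p1 pP].
pose q x : R := if x \in Z then 1 else fine (p x).
pose V x : 'M[R[i]]_d := if x \in Z then 0 else W x.
pose o x : R := if x \in Z then 0 else opnorm (W x) `^ P.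
(* The factor 2d comes from passing between [N1] and the Euclidean norm; its power is bounded by
   [powRM_const_le]. *)
pose K : R := (1 + (2 * d)%:R) `^ P.
have K0 : 0 <= K by exact: powR_ge0.
have o0 x : 0 <= o x by rewrite /o; case: ifP => // _; exact: powR_ge0.
have mo : measurable_fun [set: borel_space R n] o.
  by apply: (ZS ZO) => // x ZOx; left; right.
exists q, V, (fun x => K * (1 + o x)); split.
- split.
  + by apply: (ZS Zp) => // x Zpx; do 2!left; right.
  + move=> x; rewrite /q; case: ifPn => [_|]; first by rewrite lexx.
    by rewrite notin_setE => /pZ[].
  + apply: aeZ => x Zx; rewrite /q ifN; first by case: (pZ x Zx).
    by rewrite notin_setE.
- split.
  + move=> i j; split.
      apply: (eq_measurable_fun _ _ (ZS ZW (c (i, j, true)) 0 mZW _ (hZW _))).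
        by move=> x _; rewrite /V; case: ifP => _ //; rewrite mxE.
      by move=> x ZWx; right.
    apply: (eq_measurable_fun _ _ (ZS ZW (c (i, j, false)) 0 mZW _ (hZW _))).
      by move=> x _; rewrite /V; case: ifP => _ //; rewrite mxE.
    by move=> x ZWx; right.
  + apply: aeZ => x Zx; rewrite /V ifN; last by rewrite notin_setE.
    by apply: contrapT => dx; apply: Zx; do 3!left; right; exact: dZ2.
  + by apply: aeZ => x Zx; rewrite /V ifN// notin_setE.
- apply: measurable_funM; first exact: measurable_cst.
  by apply: measurable_funD => //; exact: measurable_cst.
- move=> x; split=> [|v v1]; first by rewrite mulr_ge0// addr_ge0.
  have B0 : 0 <= N1 v * (K * (1 + o x)) by rewrite !mulr_ge0 ?N1_ge0// addr_ge0.
  rewrite /Phi /V /q; case: ifPn => [_|xZ].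
    rewrite mul0mx powRr1; last exact: N1_ge0.
    have -> : N1 (0 : 'cV[R[i]]_d) = 0 by rewrite -(scale0r 0) N1_real normr0 mul0r.
    exact: B0.
  have /pZ[_ qP] : ~ Z x by rewrite -notin_setE.
  have d0 : 0 <= (2 * d)%:R :> R by exact: ler0n.
  have h1 : N1 (W x *m v) <= (2 * d)%:R * (opnorm (W x) * N1 v).
    apply: (le_trans (N1_le_eucl_cd _)); apply: ler_wpM2l => //.
    apply: (le_trans (eucl_cd_opnorm _ _)); apply: ler_wpM2l.
      exact: opnorm_ge0.
    exact: eucl_cd_le_N1.
  have ov0 : 0 <= opnorm (W x) * N1 v := mulr_ge0 (opnorm_ge0 _) (N1_ge0 _).
  have /andP[q1 _] := qP.
  apply: (@le_trans _ _ (((2 * d)%:R * (opnorm (W x) * N1 v)) `^ fine (p x))).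
    have t0 := mulr_ge0 d0 ov0.
    apply: ge0_ler_powR; rewrite ?nnegrE ?N1_ge0//.
    exact: le_trans q1.
  apply: (le_trans (powRM_const_le qP d0 ov0)).
  rewrite [leRHS]mulrCA; apply: ler_wpM2l => //.
  rewrite [leRHS]mulrC /o ifN//.
  apply: (powR_small qP (opnorm_ge0 _)).
  by rewrite N1_ge0.
move=> r.
have mball : measurable (eball0 r : set (borel_space R n)) by exact: measurable_eball0.
have mind := measurable_sub_indic mball.
have i0 x : 0 <= \1_(eball0 r : set 'rV[R]_n) x :> R by rewrite indicE ler0n.
have io0 x : 0 <= \1_(eball0 r) x * o x := mulr_ge0 (i0 x) (o0 x).
have mio : measurable_fun [set: borel_space R n] (fun x => \1_(eball0 r) x * o x).
  exact: (measurable_funM mind mo).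
have iio0 x : 0 <= \1_(eball0 r) x + \1_(eball0 r) x * o x := addr_ge0 (i0 x) (io0 x).
have miio : measurable_fun [set: borel_space R n]
    (fun x => \1_(eball0 r) x + \1_(eball0 r) x * o x).
  exact: (measurable_funD mind mio).
rewrite (_ : (fun x => _) = (fun x : 'rV[R]_n =>
    (K * (\1_(eball0 r) x + \1_(eball0 r) x * o x))%:E)); last first.
  by apply/funext => x; congr EFin; ring.
rewrite (integral_EFinZ mu miio iio0 K0) (integral_EFinD mu mind mio i0 io0).
have ball_fin : (\int[mu]_x (\1_(eball0 r : set 'rV[R]_n) x)%:E < +oo)%E.
  rewrite integral_EFin_indic//.
  (* Any cube containing the ball would do; |r| + 1 also covers negative r. *)
  pose t := `|r| + 1.
  apply: (@le_lt_trans _ _ (mu (cube (- t) t : set 'rV[R]_n))); last first.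
    by rewrite (measure_cube muE) ?ltry// lerNl (le_trans (_ : _ <= 0)) ?oppr_le0 ?addr_ge0.
  apply: le_measure; rewrite ?inE//; first exact: measurable_cube.
  move=> x /= xr i; have := normr_coord_le_eucl x i.
  move=> xi; have : `|x 0 i| < t.
    by rewrite (le_lt_trans xi)// (lt_trans xr)// /t (le_lt_trans (ler_norm r))// ltrDl.
  by rewrite ltr_norml => /andP[h1 h2]; rewrite h2 ltW.
have o_fin : (\int[mu]_x (\1_(eball0 r) x * o x)%:E < +oo)%E.
  apply: le_lt_trans (iO r); apply: (integral_le_lint muE).
  - by move=> x; rewrite mule_ge0// lee_fin.
  - exact/measurable_EFinP.
  - by move=> x; rewrite lee_fin.
  apply: aeZ => x Zx; rewrite /o ifN ?notin_setE// -EFinM lee_fin.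
  by rewrite ger0_norm// powR_ge0.
rewrite -ge0_fin_numE; last first.
  rewrite mule_ge0 ?lee_fin// adde_ge0//; apply: integral_ge0 => x _; rewrite lee_fin.
    exact: i0.
  exact: io0.
apply: fin_numM => //; rewrite fin_numD; apply/andP; split.
  by rewrite ge0_fin_numE//; apply: integral_ge0 => x _; rewrite lee_fin.
by rewrite ge0_fin_numE//; apply: integral_ge0 => x _; rewrite lee_fin; exact: io0.
Qed.

End borel_data.

(** * The theorem *)

Lemma epow_ge0 (R : realType) (t : R) (e : \bar R) : (0 <= epow t e)%E.
Proof.
by case: e => [r| |] /=; [rewrite lee_fin powR_ge0|case: ifP => _; rewrite ?leey|].
Qed.

(** * Comparison of the modular with [Phi] *)

Section norm_comparison.
Variables (R : realType) (n d : nat) (P : R).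
Variables (q : 'rV[R]_n -> R) (V : 'rV[R]_n -> 'M[R[i]]_d).
Variables (x : 'rV[R]_n) (r : 'cV[R[i]]_d -> R) (v : 'cV[R[i]]_d).
Hypothesis qP : 1 <= q x <= P.
Hypothesis r0 : 0 <= r v.

Let q0 : 0 <= q x.
Proof. by have /andP[q1 _] := qP; exact: le_trans q1. Qed.

Lemma epow_le_Phi : r v <= eucl_cd (V x *m v) ->
  (epow (r v) (q x)%:E <= (Phi V q x v)%:E)%E.
Proof.
move=> rV; rewrite /= lee_fin; apply: ge0_ler_powR; rewrite ?nnegrE ?N1_ge0//.
exact: le_trans rV (eucl_cd_le_N1 _).
Qed.

Lemma Phi_le_epow : eucl_cd (V x *m v) <= Num.sqrt d%:R * r v ->
  ((Phi V q x v)%:E <=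
    ((1 + (2 * d)%:R * Num.sqrt d%:R) `^ P)%:E * epow (r v) (q x)%:E)%E.
Proof.
move=> rV; rewrite /= -EFinM lee_fin.
have c0 : 0 <= (2 * d)%:R * Num.sqrt d%:R :> R by rewrite mulr_ge0 ?sqrtr_ge0.
apply: le_trans (powRM_const_le qP c0 r0).
have t0 := mulr_ge0 c0 r0.
apply: ge0_ler_powR; rewrite ?nnegrE ?N1_ge0//.
apply: (le_trans (N1_le_eucl_cd _)); rewrite -mulrA; exact: ler_wpM2l.
Qed.

(** Turns smallness of the modular into smallness of the Luxemburg norm: with a bounded exponent,
    rescaling costs only a constant. *)
Lemma Phi_scale_le (c : R) : 0 <= c ->
  Phi V q x (c%:C *: v) <= (1 + c) `^ P * Phi V q x v.
Proof.
move=> c0; rewrite /Phi -scalemxAr N1_real ger0_norm//.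
exact: (powRM_const_le qP c0 (N1_ge0 _)).
Qed.

End norm_comparison.

Theorem theorem3p2 (R : realType) (n d : nat)
    (p : 'rV[R]_n -> \bar R)
    (rho : 'rV[R]_n -> 'cV[R[i]]_d -> R)
    (W : 'rV[R]_n -> 'M[R[i]]_d)
    (F : set ('rV[R]_n -> 'cV[R[i]]_d)) :
  (* p : R^n -> [1, oo] measurable with p_+ < oo *)
  lmeas_efun p ->
  (forall x, (1 <= p x)%E) ->
  (ess_sup_rn p < +oo)%E ->
  (* rho is a family of norms on C^d *)
  (forall x, is_norm (rho x)) ->
  (* standing assumption: x |-> rho_x(f(x)) is measurable for measurable f *)
  (forall f, lmeas_cfun f -> lmeas_rfun (fun x => rho x (f x))) ->
  (* W_x positive-definite self-adjoint, comparable to rho_x *)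
  (forall x, self_adjoint (W x) /\ pos_definite (W x)) ->
  (forall x v, rho x v <= eucl_cd (W x *m v) /\
               eucl_cd (W x *m v) <= Num.sqrt (d%:R) * rho x v) ->
  inv_matrix_weight W ->
  L1loc (fun x => opnorm (W x) `^ fine (ess_sup_rn p)) ->
  (* F is a subset of L^{p(.)}(rho) *)
  F `<=` in_Lp p rho ->
  (* (a) *)
  (exists M : R, forall f, F f -> (modular p rho f <= M%:E)%E) ->
  (* (b) *)
  (forall eps : R, 0 < eps -> exists R0 : R, forall r : R, R0 < r ->
     forall f, F f ->
       (lint (fun x => (\1_(~` eball0 r) x)%:E * epow (rho x (f x)) (p x)) <= eps%:E)%E) ->
  (* (c) *)
  (forall eps : R, 0 < eps -> exists delta : R, 0 < delta /\
     forall r : R, 0 < r < delta -> forall f, F f -> forall y : 'rV[R]_n,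
       eucl_rn y < r ->
       (modular p rho (fun x => (f (x - y) - f x)%R) <= eps%:E)%E) ->
  totally_bounded_Lp p rho F.
Proof.
move=> p_meas p1 p_bdd rho_norm _ _ rhoW W_weight W_int FLp [M FM] Ftail Ftrans.
have [mu muE] := intB_measure R n.
have [q [V [beta [[mq qP pq] [mV dV WV] mbeta betaP beta_int]]]] :=
  borel_exponent_weight muE p_meas p1 p_bdd W_weight W_int.
set P := fine (ess_sup_rn p) in qP.
have rho0 x v : 0 <= rho x v by have [] := rho_norm x.
have good : {ae mu, forall x, p x = (q x)%:E /\ W x = V x}.
  by apply: ae_mono2 pq WV.
pose D : R := (1 + (2 * d)%:R * Num.sqrt d%:R) `^ P.
have D0 : 0 < D.
  by apply: powR_gt0; rewrite (lt_le_trans ltr01)// lerDl mulr_ge0// sqrtr_ge0.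
have PhiD x v : p x = (q x)%:E /\ W x = V x ->
    ((Phi V q x v)%:E <= D%:E * epow (rho x v) (p x))%E.
  by move=> [-> WVx]; apply: Phi_le_epow => //; rewrite -WVx; case: (rhoW x v).
have epowPhi x v : p x = (q x)%:E /\ W x = V x ->
    (epow (rho x v) (p x) <= (Phi V q x v)%:E)%E.
  move=> [-> WVx]; apply: (epow_le_Phi (qP x)) => //.
  by rewrite -WVx; case: (rhoW x v).
(* [tf f] is a Borel version of f. The estimates are made on these, while the net itself consists of
   the original members of F. *)
have [tf htf] : exists tf : ('rV[R]_n -> 'cV[R[i]]_d) -> 'rV[R]_n -> 'cV[R[i]]_d,
    forall f, F f -> borel_vfun (tf f) /\ {ae mu, forall x, f x = tf f x}.
  have h f : exists g, F f -> borel_vfun g /\ {ae mu, forall x, f x = g x}.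
    have [Ff|nF] := pselect (F f); last by exists f.
    by have [g mg fg] := borel_version muE (FLp f Ff).1; exists g.
  by have [tf htf] := choice h; exists tf.
move=> eps eps0.
(* The norm will be at most [lam]; half of eps gives the strict inequality required. *)
pose lam := eps / 2; have lam0 : 0 < lam by rewrite divr_gt0.
have lamV0 : 0 <= lam^-1 by rewrite invr_ge0 ltW.
(* The cost of dividing by [lam] in the modular. Closeness L^-1 before rescaling therefore gives
   modular at most 1 afterwards. *)
pose L := (1 + lam^-1) `^ P.
have L0 : 0 < L by apply: powR_gt0; rewrite (lt_le_trans ltr01)// lerDl.
have LV0 : 0 < L^-1 by rewrite invr_gt0.
pose G := [set tf f | f in F].
have mPhi f : F f -> measurable_fun [set: borel_space R n] (fun x => Phi V q x (tf f x)).
  by move=> Ff; exact: (measurable_Phi_id mV mq (htf f Ff).1).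
have mG g : G g -> borel_vfun g by move=> [f Ff <-]; exact: (htf f Ff).1.
have GM g : G g -> (\int[mu]_x (Phi V q x (g x))%:E <= (D * M)%:E)%E.
  move=> [f Ff <-].
  apply: (integral_le_of_lint muE D0 (mPhi f Ff)) (FM f Ff).
  - by move=> x; exact: Phi_ge0.
  - by move=> x; exact: epow_ge0.
  apply: ae_mono2 good (htf f Ff).2 => x gx fx.
  by rewrite -fx; exact: PhiD.
have Gtail e : 0 < e -> exists r, forall g, G g ->
    (\int[mu]_x (\1_(~` eball0 r) x * Phi V q x (g x))%:E <= e%:E)%E.
  move=> e0; have [R0 hR0] := Ftail (e / D) (divr_gt0 e0 D0).
  exists (R0 + 1) => _ [f Ff <-].
  have R01 : R0 < R0 + 1 by rewrite ltrDl.
  have hb := hR0 (R0 + 1) R01 f Ff.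
  have eE : D * (e / D) = e by rewrite mulrC divfK// gt_eqF.
  rewrite -[X in (_ <= X%:E)%E]eE; apply: (integral_le_of_lint muE D0 _ _ _ _ hb).
  - apply: measurable_funM; last exact: mPhi.
    exact: (measurable_sub_indic (measurableC (measurable_eball0 _))).
  - by move=> x; rewrite mulr_ge0 ?Phi_ge0// indicE ler0n.
  - by move=> x; rewrite mule_ge0 ?epow_ge0// lee_fin indicE ler0n.
  apply: ae_mono2 good (htf f Ff).2 => x gx fx.
  rewrite -fx EFinM muleCA; apply: lee_wpmul2l; last exact: PhiD.
  by rewrite lee_fin indicE ler0n.
have Gtrans e : 0 < e -> exists2 r, 0 < r & forall g, G g -> forall y : 'rV[R]_n,
    (forall i, `|y 0 i| <= r) ->
    (\int[mu]_x (Phi V q x (g (x + y) - g x))%:E <= e%:E)%E.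
  move=> e0; have [del [del0 hdel]] := Ftrans (e / D) (divr_gt0 e0 D0).
  (* Coordinates below this bound give Euclidean norm at most del / 4, hence less than the radius
     del / 2 used in (c); n+1 allows n = 0. *)
  exists (del / (4 * n.+1%:R)); first by rewrite divr_gt0// mulr_gt0.
  move=> _ [f Ff <-] y yr; have [mf fae] := htf f Ff.
  have yn : eucl_rn (- y) < del / 2.
    have r0 : 0 < del / (4 * n.+1%:R) by rewrite divr_gt0// mulr_gt0.
    apply: le_lt_trans (eucl_rn_le (ltW r0) _) _.
      by move=> i; rewrite mxE normrN.
    rewrite (_ : _ * _ = del / 4 * (n%:R / n.+1%:R)); last first.
      by field; rewrite addrC natr1 pnatr_eq0.
    apply: (@le_lt_trans _ _ (del / 4)); last by lra.
    apply: ler_piMr; first by lra.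
    by rewrite ler_pdivrMr// mul1r ler_nat.
  have del2 : 0 < del / 2 < del by lra.
  (* The translate in (c) is f(x - y), while sampling uses f(x + y), hence the sign. *)
  have hy := hdel _ del2 f Ff (- y) yn.
  have eE : D * (e / D) = e by rewrite mulrC divfK// gt_eqF.
  rewrite -[X in (_ <= X%:E)%E]eE; apply: (integral_le_of_lint muE D0 _ _ _ _ hy).
  - apply: (measurable_Phi_id mV mq); apply: mx_cmeasurableB => //.
    apply: (@mx_cmeasurable_comp _ _ _ (borel_space R n)
      (borel_space R n) _ _ (tf f) (fun x => x + y)) => //.
    apply: (@measurable_addrow R n _ (borel_space R n) id (fun=> y)).
      exact: measurable_id.
    exact: (@measurable_cst _ _ _ (borel_space R n)).
  - by move=> x; exact: Phi_ge0.
  - by move=> x; exact: epow_ge0.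
  have fae' : {ae mu, forall x, f (x + y) = tf f (x + y)}.
    exact: (negligible_translation muE y fae).
  have ff : {ae mu, forall x, f (x - - y) - f x = tf f (x + y) - tf f x}.
    by apply: ae_mono2 fae fae' => x e1 e2; rewrite opprK e1 e2.
  apply: ae_mono2 good ff => x gx fx.
  by rewrite -fx; exact: PhiD.
have [Gam [rel [rel_ex rel_close]]] := core_net mV mq qP muE dV mG mbeta
  (fun x => (betaP x).1) (fun x => (betaP x).2) beta_int GM Gtail Gtrans LV0.
have [k [g [Fg gnet]]] := @finite_choice_net _ F Gam (fun f => rel (tf f))
  (fun f Ff => rel_ex (tf f) (ex_intro2 _ _ f Ff erefl)).
exists k, g; split=> [j|f Ff]; first exact: FLp.
have [j [c [fc gc]]] := gnet f Ff; exists j.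
have [mf fae] := htf f Ff; have [mg gae] := htf (g j) (Fg j).
have fgae : {ae mu, forall x, f x - g j x = tf f x - tf (g j) x}.
  by apply: ae_mono2 fae gae => x -> ->.
have close := rel_close _ _ c (ex_intro2 _ _ f Ff erefl)
  (ex_intro2 _ _ (g j) (Fg j) erefl) fc gc.
have mfg := measurable_Phi_id mV mq (mx_cmeasurableB mf mg).
have Phi0 x : 0 <= Phi V q x (tf f x - tf (g j) x) by exact: Phi_ge0.
apply: (@le_lt_trans _ _ lam%:E); last by rewrite lte_fin /lam; lra.
apply: ereal_inf_lbound; exists lam => //; split=> //.
apply: (@le_trans _ _ (\int[mu]_x (L * Phi V q x (tf f x - tf (g j) x))%:E)%E).
  apply: (lint_le_integral muE).
  - by apply/measurable_EFinP; exact: (measurable_funM (measurable_cst L) mfg).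
  - by move=> x; rewrite lee_fin; exact: (mulr_ge0 (ltW L0) (Phi0 x)).
  apply: ae_mono2 good fgae => x gx fgx.
  rewrite fgx; apply: (le_trans (epowPhi _ _ gx)); rewrite lee_fin.
  exact: (Phi_scale_le _ _ (qP x) lamV0).
rewrite (integral_EFinZ mu mfg Phi0 (ltW L0)).
apply: (@le_trans _ _ (L%:E * (L^-1)%:E)%E).
  by apply: lee_wpmul2l => //; rewrite lee_fin ltW.
by rewrite -EFinM mulfV ?gt_eqF.
Qed.
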